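(* Let $d\ge 2$ be a natural number. (1) If $A$ is a pseudomatricial C$^*$-algebra with identity $I$, then there are mutually orthogonal projections $p_1,\dots,p_d,r_1,\dots,r_{d-1}$ in $A$ such that $I=\sum_{i=1}^d p_i+\sum_{j=1}^{d-1}r_j$, the projections $p_1,\dots,p_d$ are pairwise Murray-von Neumann equivalent, and each $r_j$ is either a minimal projection or zero. (2) If $A$ is a pseudocompact C$^*$-algebra with identity $I$, then there are mutually orthogonal projections $p_1,\dots,p_d,r_1,\dots,r_{d-1}$ in $A$ such that $I=\sum_{i=1}^d p_i+\sum_{j=1}^{d-1}r_j$, the projections $p_1,\dots,p_d$ are pairwise Murray-von Neumann equivalent, and each $r_j$ is either an abelian projection or zero.
   Context: A nonzero projection $p$ is minimal if it has no subprojection other than $0$ and $p$; a projection $r\in A$ is abelian if $rAr$ is commutative. Projections $p,q$ are Murray-von Neumann equivalent if $p=v^*v$, $q=vv^*$ for some $v\in A$. $M_n$ denotes the C$^*$-algebra of complex $n\times n$ matrices, $n\ge 1$. Finite-dimensional C$^*$-algebras are, up to isomorphism, the (nonempty) finite direct sums of matrix algebras $M_n$. Continuous logic for C$^*$-algebras: atomic formulae are norms $\|P(x_1,\dots,x_k)\|$ of $*$-polynomials with complex coefficients (a constant $I$ for the identity may be used when the algebras are unital); formulae are built from these by applying continuous real-valued functions to finitely many formulae and by taking $\sup$ or $\inf$ of a variable over the closed unit ball. A sentence is a formula without free variables; $\varphi^A\in\mathbb{R}$ is its value in $A$. $A\equiv B$ (elementarily equivalent) if $\varphi^A=\varphi^B$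 for every sentence $\varphi$. For an ultrafilter $\mathcal{U}$ on a set $J$, the ultraproduct $\prod_{\mathcal{U}}A_i$ is the C$^*$-algebra of bounded families $(a_i)_{i\in J}$ modulo those with $\lim_{\mathcal{U}}\|a_i\|=0$. A C$^*$-algebra is pseudocompact if it is elementarily equivalent to an ultraproduct of finite-dimensional C$^*$-algebras, and pseudomatricial if it is elementarily equivalent to an ultraproduct of matrix algebras; it is not required to be infinite-dimensional. Such algebras are unital. *)

(* Defs.v *)
From HB Require Import structures.
From mathcomp Require Import all_boot all_order all_algebra.
From mathcomp Require Import complex.
From mathcomp Require Import boolp classical_sets functions reals.
From mathcomp Require Import topology normedtype.

Set Implicit Arguments.
Unset Strict Implicit.
Unset Printing Implicit Defensive.

Import Order.TTheory GRing.Theory Num.Theory.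
Import numFieldNormedType.Exports.

Local Open Scope classical_set_scope.
Local Open Scope complex_scope.
Local Open Scope quotient_scope.
Local Open Scope ring_scope.

(* Unital C*-algebras over the complex numbers [R[i]].  A [GRing.Algebra] is a
   nonzero ring; this excludes only the zero algebra, which is not elementarily
   equivalent to a nonzero unital C*-algebra (the norm of the identity differs).
   The norm is part of this mixin, and completeness is spelled out with Cauchy
   sequences, because the hierarchy has no normed algebras: a structure joining
   [GRing.PzSemiRing] and [Num.SemiNormedZmodule] cannot be declared above
   [Num.NumDomain], which already inherits from both. *)
HB.mixin Record isCStarAlgebra (R : realType) A & GRing.Algebra R[i] A := {
  star : A -> A ;
  starD : forall x y : A, star (x + y) = star x + star y ;
  starZ : forall (k : R[i]) (x : A), star (k *: x) = k^* *: star x ;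
  starM : forall x y : A, star (x * y) = star y * star x ;
  starK : forall x : A, star (star x) = x ;
  cnorm : A -> R ;
  cnormD : forall x y : A, cnorm (x + y) <= cnorm x + cnorm y ;
  cnormZ : forall (k : R[i]) (x : A), cnorm (k *: x) = Normc.normc k * cnorm x ;
  cnorm_eq0 : forall x : A, cnorm x = 0 -> x = 0 ;
  cnormM : forall x y : A, cnorm (x * y) <= cnorm x * cnorm y ;
  cnorm_star : forall x : A, cnorm (star x * x) = cnorm x ^+ 2 ;
  cnorm_complete : forall u : nat -> A,
    (forall e : R, 0 < e -> exists N : nat, forall m n : nat,
       (N <= m)%N -> (N <= n)%N -> cnorm (u m - u n) < e) ->
    exists l : A, forall e : R, 0 < e -> exists N : nat, forall n : nat,
       (N <= n)%N -> cnorm (u n - l) < e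
}.

#[short(type="cstarAlgType")]
HB.structure Definition CStarAlgebra (R : realType) :=
  { A of GRing.Algebra R[i] A & isCStarAlgebra R A }.

Section CStarTheory.
Variables (R : realType) (A : cstarAlgType R).
Implicit Types x y : A.

Lemma cnorm0 : cnorm (0 : A) = 0.
Proof. by rewrite -(scale0r (0 : A)) cnormZ Normc.normc0 mul0r. Qed.

Lemma normcN1 : Normc.normc (-1 : R[i]) = 1.
Proof. by rewrite /Normc.normc /= sqrrN expr1n oppr0 expr0n addr0 sqrtr1. Qed.

Lemma cnormN x : cnorm (- x) = cnorm x.
Proof. by rewrite -scaleN1r cnormZ normcN1 mul1r. Qed.

Lemma cnorm_ge0 x : 0 <= cnorm x.
Proof.
have := cnormD x (- x); rewrite subrr cnorm0 cnormN -mulr2n.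
by rewrite pmulrn_lge0.
Qed.

Lemma cdistC x y : cnorm (x - y) = cnorm (y - x).
Proof. by rewrite -cnormN opprB. Qed.

Lemma cdistD z x y : cnorm (x - y) <= cnorm (x - z) + cnorm (z - y).
Proof. by apply: le_trans (cnormD _ _); rewrite addrA subrK. Qed.

Lemma cdist_dist x y : `|cnorm x - cnorm y| <= cnorm (x - y).
Proof.
have H (a b : A) : cnorm a - cnorm b <= cnorm (a - b).
  by rewrite lerBlDr; apply: le_trans (cnormD _ _); rewrite subrK.
by rewrite ler_norml lerNl opprB [cnorm (x - y)]cdistC H cdistC H.
Qed.

Lemma star0 : star (0 : A) = 0.
Proof. by rewrite -(scale0r (0 : A)) starZ rmorph0 !scale0r. Qed.

Lemma starN x : star (- x) = - star x.
Proof. by rewrite -scaleN1r starZ rmorphN rmorph1 scaleN1r. Qed.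

Lemma star1 : star (1 : A) = 1.
Proof. by rewrite -[LHS]mulr1 -[X in _ * X]starK -starM mulr1 starK. Qed.

Lemma cnormS x : cnorm (star x) = cnorm x.
Proof.
have H (y : A) : cnorm y <= cnorm (star y).
  have [->|y0] := eqVneq (cnorm y) 0; first exact: cnorm_ge0.
  have yp : 0 < cnorm y by rewrite lt_neqAle eq_sym y0 cnorm_ge0.
  by rewrite -(ler_pM2r yp) -expr2 -cnorm_star cnormM.
by apply/le_anti; rewrite H -{2}[x]starK H.
Qed.

Lemma cnorm1 : cnorm (1 : A) = 1.
Proof.
have := cnorm_star (1 : A); rewrite star1 mulr1 expr2 => /eqP.
rewrite -[X in X == _]mulr1 -subr_eq0 -mulrBr mulf_eq0 subr_eq0 => /orP[/eqP/cnorm_eq0|/eqP <- //].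
by move/eqP; rewrite oner_eq0.
Qed.

End CStarTheory.

Section RealAux.
Variable R : realType.

Lemma exists_half_exp (e : R) : 0 < e -> exists n : nat, 2^-1 ^+ n < e.
Proof.
move=> e0; have e1 : 0 <= e^-1 by rewrite invr_ge0 ltW.
exists (Num.bound e^-1); rewrite exprVn invf_plt ?posrE ?exprn_gt0 //.
apply: lt_le_trans (archi_boundP e1) _.
by rewrite -natrX ler_nat ltnW // ltn_expl.
Qed.

Variables (J : Type) (U : set_system J).
Hypothesis UF : UltraFilter U.

Lemma ultra_cvg (h : J -> R) (M : R) :
  (forall j, `|h j| <= M) -> cvg (h j @[j --> U]).
Proof.
move=> hM; have ultra_h : UltraFilter (h j @[j --> U]).
  split; first exact: fmap_proper_filter.
  move=> G GF hG; rewrite predeqE => X; split; last exact: hG.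
  move=> GX; have [//|Un] := in_ultra_setVsetC (h @^-1` X) UF.
  have : G (~` X) by apply: hG.
  move=> GnX; have /filter_ex[? []//] := @filterI _ G (@filter_filter _ _ GF) _ _ GX GnX.
have := @segment_compact R (- M) M; rewrite compact_ultra => /(_ _ ultra_h).
case; first by apply: (@filterE _ U) => j; rewrite /= in_itv /= -ler_norml.
by move=> l [_ hl]; apply/cvg_ex; exists l.
Qed.

Lemma ultra_ler_lim (f g : J -> R) :
  cvg (f j @[j --> U]) -> cvg (g j @[j --> U]) -> (forall j, f j <= g j) ->
  lim (f j @[j --> U]) <= lim (g j @[j --> U]).
Proof.
move=> cf cg fg; rewrite -subr_ge0.
have cgf : g j - f j @[j --> U] -->
    lim (g j @[j --> U]) - lim (f j @[j --> U]) by exact: cvgB.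
apply: (cvgr_to_ge (b := 0) cgf).
by apply: (@filterE _ U) => j; rewrite /= subr_ge0.
Qed.

End RealAux.

Section Ultraproduct.
Variables (R : realType) (J : Type) (U : set_system J).
Hypothesis UF : UltraFilter U.
Variable B : J -> cstarAlgType R.

Record bounded_family := BoundedFamily {
  family_val :> forall j, B j ;
  family_bounded : exists M : R, forall j, cnorm (family_val j) <= M }.

HB.instance Definition _ := gen_eqMixin bounded_family.
HB.instance Definition _ := gen_choiceMixin bounded_family.

Implicit Types a b c d : bounded_family.

Definition family_null a := cnorm (a j) @[j --> U] --> (0 : R).

Lemma familyP a b : (forall j, a j = b j) -> a = b.
Proof.
case: a b => [a aM] [b bM] /= ab.
have eab : a = b by apply: functional_extensionality_dep.
by rewrite eab in aM *; congr BoundedFamily; exact: Prop_irrelevance.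
Qed.

Fact family_add_bounded a b :
  exists M : R, forall j, cnorm (a j + b j) <= M.
Proof.
have [[Ma aM] [Mb bM]] := (family_bounded a, family_bounded b).
exists (Ma + Mb) => j; apply: le_trans (cnormD _ _) _; exact: lerD.
Qed.
Definition family_add a b := BoundedFamily (family_add_bounded a b).

Fact family_scale_bounded (k : R[i]) a :
  exists M : R, forall j, cnorm (k *: a j) <= M.
Proof.
have [Ma aM] := family_bounded a.
exists (Normc.normc k * Ma) => j; rewrite cnormZ ler_wpM2l //.
by case: k => ? ?; exact: sqrtr_ge0.
Qed.
Definition family_scale k a := BoundedFamily (family_scale_bounded k a).

Fact family_opp_bounded a : exists M : R, forall j, cnorm (- a j) <= M.
Proof. by have [M aM] := family_bounded a; exists M => j; rewrite cnormN. Qed.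
Definition family_opp a := BoundedFamily (family_opp_bounded a).

Fact family_mul_bounded a b :
  exists M : R, forall j, cnorm (a j * b j) <= M.
Proof.
have [[Ma aM] [Mb bM]] := (family_bounded a, family_bounded b).
exists (Ma * Mb) => j; apply: le_trans (cnormM _ _) _.
by apply: ler_pM; rewrite ?cnorm_ge0.
Qed.
Definition family_mul a b := BoundedFamily (family_mul_bounded a b).

Fact family_star_bounded a : exists M : R, forall j, cnorm (star (a j)) <= M.
Proof. by have [M aM] := family_bounded a; exists M => j; rewrite cnormS. Qed.
Definition family_star a := BoundedFamily (family_star_bounded a).

Fact family_zero_bounded : exists M : R, forall j, cnorm (0 : B j) <= M.
Proof. by exists 0 => j; rewrite cnorm0. Qed.
Definition family_zero := BoundedFamily family_zero_bounded.

Fact family_one_bounded : exists M : R, forall j, cnorm (1 : B j) <= M.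
Proof. by exists 1 => j; rewrite cnorm1. Qed.
Definition family_one := BoundedFamily family_one_bounded.

Lemma family_nullP a :
  family_null a <-> forall e : R, 0 < e -> \forall j \near U, cnorm (a j) < e.
Proof.
split=> [/cvgrPdist_lt a0 e e0|a0].
  have := a0 e e0; apply: filterS => j.
  by rewrite sub0r normrN ger0_norm ?cnorm_ge0.
apply/cvgrPdist_lt => e e0; have := a0 e e0; apply: filterS => j.
by rewrite sub0r normrN ger0_norm ?cnorm_ge0.
Qed.

Lemma family_null_le a b (M : R) : (forall j, cnorm (a j) <= M * cnorm (b j)) ->
  family_null b -> family_null a.
Proof.
move=> ab /family_nullP b0; apply/family_nullP => e e0.
have M0 : 0 < `|M| + 1 by rewrite ltr_wpDl.
have := b0 (e / (`|M| + 1)) (divr_gt0 e0 M0); apply: filterS => j.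
rewrite ltr_pdivlMr // => /(le_lt_trans _); apply; apply: le_trans (ab j) _.
rewrite mulrC ler_wpM2l ?cnorm_ge0 //.
by rewrite (le_trans (ler_norm M)) // lerDl.
Qed.

Lemma family_null_add a b :
  family_null a -> family_null b -> family_null (family_add a b).
Proof.
move=> /family_nullP a0 /family_nullP b0; apply/family_nullP => e e0.
have e2 : 0 < e / 2 by rewrite divr_gt0.
apply: filterS2 (a0 _ e2) (b0 _ e2) => j aj bj /=.
by apply: le_lt_trans (cnormD _ _) _; rewrite [e]splitr ltrD.
Qed.

Definition family_eqv a b : bool :=
  `[< family_null (family_add a (family_opp b)) >].

Fact family_eqv_equiv : equiv_class_of family_eqv.
Proof.
split=> [a|a b|b a c].
- apply/asboolP/family_nullP => e e0; apply: filterE => j /=.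
  by rewrite subrr cnorm0.
- apply/asbool_equiv_eq.
  have H c d : family_null (family_add c (family_opp d)) ->
      family_null (family_add d (family_opp c)).
    by apply: (@family_null_le _ _ 1) => j /=; rewrite mul1r cdistC.
  by split; exact: H.
- move=> /asboolP ab /asboolP bc; apply/asboolP.
  have := family_null_add ab bc; apply: (@family_null_le _ _ 1) => j /=.
  by rewrite mul1r addrA subrK.
Qed.

Canonical family_eqv_rel := EquivRelPack family_eqv_equiv.

(* Bounded families modulo those whose norms tend to 0 along [U]; the
   operations are pointwise and the norm of a class is the limit along [U] of
   the norms of a representative ([up_addE], [up_mulE], [up_starE],
   [up_normE], etc). *)
Definition ultraproduct := {eq_quot family_eqv_rel}.

HB.instance Definition _ := Choice.on ultraproduct.
HB.instance Definition _ := EqQuotient.on ultraproduct.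

Implicit Types x y : ultraproduct.
Local Notation cls := (\pi_ultraproduct).

Lemma up_eqP a b : cls a = cls b <->
  family_null (family_add a (family_opp b)).
Proof.
split=> [/eqP|ab]; first by rewrite eqmodE => /asboolP.
by apply/eqP; rewrite eqmodE; apply/asboolP.
Qed.

Lemma up_eq_dist a b c d (M : R) :
  (forall j, cnorm (c j - d j) <= M * cnorm (a j - b j)) ->
  cls a = cls b ->
  cls c = cls d.
Proof. by move=> H /up_eqP ab; apply/up_eqP; exact: family_null_le ab. Qed.

Definition up_add x y := cls (family_add (repr x) (repr y)).
Definition up_mul x y := cls (family_mul (repr x) (repr y)).
Definition up_scale k x := cls (family_scale k (repr x)).
Definition up_opp x := cls (family_opp (repr x)).
Definition up_star x := cls (family_star (repr x)).
Definition up_zero := cls family_zero.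
Definition up_one := cls family_one.
Definition up_norm x : R := lim (cnorm (repr x j) @[j --> U]).

Lemma repr_pi a : cls (repr (cls a)) = cls a.
Proof. exact: reprK. Qed.

Lemma up_addE a b : up_add (cls a) (cls b) = cls (family_add a b).
Proof.
apply: (@etrans _ _ (cls (family_add a (repr (cls b))))).
  apply: (@up_eq_dist _ _ _ _ 1) (repr_pi a) => j /=; rewrite mul1r.
  by rewrite opprD addrACA subrr addr0.
apply: (@up_eq_dist _ _ _ _ 1) (repr_pi b) => j /=; rewrite mul1r.
by rewrite opprD addrACA subrr add0r.
Qed.

Lemma up_mulE a b : up_mul (cls a) (cls b) = cls (family_mul a b).
Proof.
apply: (@etrans _ _ (cls (family_mul a (repr (cls b))))).
  have [M bM] := family_bounded (repr (cls b)).
  apply: (@up_eq_dist _ _ _ _ M) (repr_pi a) => j /=; rewrite -mulrBl.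
  by apply: le_trans (cnormM _ _) _; rewrite mulrC ler_wpM2r ?cnorm_ge0.
have [M aM] := family_bounded a.
apply: (@up_eq_dist _ _ _ _ M) (repr_pi b) => j /=; rewrite -mulrBr.
by apply: le_trans (cnormM _ _) _; rewrite ler_wpM2r ?cnorm_ge0.
Qed.

Lemma up_scaleE k a : up_scale k (cls a) = cls (family_scale k a).
Proof.
by apply: (@up_eq_dist _ _ _ _ (Normc.normc k)) (repr_pi a) => j /=;
  rewrite -scalerBr cnormZ.
Qed.

Lemma up_oppE a : up_opp (cls a) = cls (family_opp a).
Proof.
by apply: (@up_eq_dist _ _ _ _ 1) (repr_pi a) => j /=; rewrite mul1r -opprD cnormN.
Qed.

Lemma up_starE a : up_star (cls a) = cls (family_star a).
Proof.
apply: (@up_eq_dist _ _ _ _ 1) (repr_pi a) => j /=.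
by rewrite mul1r -starN -starD cnormS.
Qed.

Lemma family_norm_cvg a : cvg (cnorm (a j) @[j --> U]).
Proof.
have [M aM] := family_bounded a; apply: (@ultra_cvg _ _ _ UF _ M) => j.
by rewrite ger0_norm ?cnorm_ge0.
Qed.

Lemma up_normE a : up_norm (cls a) = lim (cnorm (a j) @[j --> U]).
Proof.
have /up_eqP/family_nullP raN := repr_pi a.
rewrite /up_norm; set b := repr _ in raN *.
apply: cvg_lim => //; apply/cvgrPdist_lt => e e0.
have e2 : 0 < e / 2 by rewrite divr_gt0.
have /cvgrPdist_lt aN : cnorm (a j) @[j --> U] -->
    lim (cnorm (a j) @[j --> U]) by exact: family_norm_cvg.
apply: filterS2 (aN _ e2) (raN _ e2) => j aj bj /=.
rewrite [e]splitr; apply: le_lt_trans (ltrD aj bj).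
rewrite -[X in `|X - _|](subrK (cnorm (a j))) -addrA.
apply: le_trans (ler_normD _ _) _; rewrite lerD2l.
by apply: le_trans (cdist_dist _ _) _; rewrite cdistC.
Qed.

Fact up_addA : associative up_add.
Proof.
elim/quotW=> a; elim/quotW=> b; elim/quotW=> c.
rewrite (up_addE b c) (up_addE a b) !up_addE.
by congr (cls _); apply: familyP => j /=; rewrite addrA.
Qed.

Fact up_addC : commutative up_add.
Proof.
elim/quotW=> a; elim/quotW=> b; rewrite !up_addE.
by congr (cls _); apply: familyP => j /=; rewrite addrC.
Qed.

Fact up_add0 : left_id up_zero up_add.
Proof.
elim/quotW=> a; rewrite !up_addE.
by congr (cls _); apply: familyP => j /=; rewrite add0r.
Qed.

Fact up_addN : left_inverse up_zero up_opp up_add.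
Proof.
elim/quotW=> a; rewrite up_oppE up_addE.
by congr (cls _); apply: familyP => j /=; rewrite addNr.
Qed.

HB.instance Definition _ :=
  GRing.isZmodule.Build ultraproduct up_addA up_addC up_add0 up_addN.

Fact up_mulA : associative up_mul.
Proof.
elim/quotW=> a; elim/quotW=> b; elim/quotW=> c.
rewrite (up_mulE b c) (up_mulE a b) !up_mulE.
by congr (cls _); apply: familyP => j /=; rewrite mulrA.
Qed.

Fact up_mul1 : left_id up_one up_mul.
Proof.
elim/quotW=> a; rewrite up_mulE.
by congr (cls _); apply: familyP => j /=; rewrite mul1r.
Qed.

Fact up_mulr1 : right_id up_one up_mul.
Proof.
elim/quotW=> a; rewrite up_mulE.
by congr (cls _); apply: familyP => j /=; rewrite mulr1.
Qed.

Fact up_mulDl : left_distributive up_mul up_add.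
Proof.
elim/quotW=> a; elim/quotW=> b; elim/quotW=> c.
rewrite (up_addE a b) (up_mulE a c) (up_mulE b c) up_addE up_mulE.
by congr (cls _); apply: familyP => j /=; rewrite mulrDl.
Qed.

Fact up_mulDr : right_distributive up_mul up_add.
Proof.
elim/quotW=> a; elim/quotW=> b; elim/quotW=> c.
rewrite (up_addE b c) (up_mulE a b) (up_mulE a c) up_addE up_mulE.
by congr (cls _); apply: familyP => j /=; rewrite mulrDr.
Qed.

Fact up_one_neq0 : up_one != 0 :> ultraproduct.
Proof.
apply/eqP => /up_eqP/family_nullP/(_ 1 ltr01)/filter_ex[j] /=.
by rewrite subr0 cnorm1 ltxx.
Qed.

HB.instance Definition _ := GRing.Zmodule_isNzRing.Build ultraproduct
  up_mulA up_mul1 up_mulr1 up_mulDl up_mulDr up_one_neq0.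

Fact up_scaleA k l x : up_scale k (up_scale l x) = up_scale (k * l) x.
Proof.
elim/quotW: x => a; rewrite (up_scaleE l a) !up_scaleE.
by congr (cls _); apply: familyP => j /=; rewrite scalerA.
Qed.

Fact up_scale1 : left_id 1 up_scale.
Proof.
elim/quotW=> a; rewrite !up_scaleE.
by congr (cls _); apply: familyP => j /=; rewrite scale1r.
Qed.

Fact up_scaleDr : right_distributive up_scale +%R.
Proof.
move=> k; elim/quotW=> a; elim/quotW=> b.
change (up_scale k (up_add (cls a) (cls b)) =
  up_add (up_scale k (cls a)) (up_scale k (cls b))).
rewrite (up_addE a b) (up_scaleE k a) (up_scaleE k b) up_addE up_scaleE.
by congr (cls _); apply: familyP => j /=; rewrite scalerDr.
Qed.

Fact up_scaleDl x : {morph up_scale^~ x : k l / k + l}.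
Proof.
move=> k l; elim/quotW: x => a.
change (up_scale (k + l) (cls a) =
  up_add (up_scale k (cls a)) (up_scale l (cls a))).
rewrite (up_scaleE k a) (up_scaleE l a) up_scaleE up_addE.
by congr (cls _); apply: familyP => j /=; rewrite scalerDl.
Qed.

HB.instance Definition _ := GRing.Zmodule_isLmodule.Build R[i] ultraproduct
  up_scaleA up_scale1 up_scaleDr up_scaleDl.

Fact up_scaleAl (k : R[i]) x y : k *: (x * y) = (k *: x) * y.
Proof.
change (up_scale k (up_mul x y) = up_mul (up_scale k x) y).
elim/quotW: x => a; elim/quotW: y => b;
  rewrite (up_mulE a b) (up_scaleE k a) up_scaleE up_mulE.
by congr (cls _); apply: familyP => j /=; rewrite scalerAl.
Qed.

HB.instance Definition _ :=
  GRing.Lmodule_isLalgebra.Build R[i] ultraproduct up_scaleAl.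

Fact up_scaleAr (k : R[i]) x y : k *: (x * y) = x * (k *: y).
Proof.
change (up_scale k (up_mul x y) = up_mul x (up_scale k y)).
elim/quotW: x => a; elim/quotW: y => b;
  rewrite (up_mulE a b) (up_scaleE k b) up_scaleE up_mulE.
by congr (cls _); apply: familyP => j /=; rewrite scalerAr.
Qed.

HB.instance Definition _ :=
  GRing.Lalgebra_isAlgebra.Build R[i] ultraproduct up_scaleAr.

Lemma piD a b : cls a + cls b = cls (family_add a b).
Proof. exact: up_addE. Qed.
Lemma piN a : - cls a = cls (family_opp a).
Proof. exact: up_oppE. Qed.
Lemma piM a b : cls a * cls b = cls (family_mul a b).
Proof. exact: up_mulE. Qed.
Lemma piZ (k : R[i]) a : k *: cls a = cls (family_scale k a).
Proof. exact: up_scaleE. Qed.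

Fact up_starD x y : up_star (x + y) = up_star x + up_star y.
Proof.
elim/quotW: x => a; elim/quotW: y => b;
rewrite (piD a b) (up_starE a) (up_starE b) piD up_starE.
by congr (cls _); apply: familyP => j /=; rewrite starD.
Qed.

Fact up_starZ (k : R[i]) x : up_star (k *: x) = k^* *: up_star x.
Proof.
elim/quotW: x => a; rewrite (piZ k a) (up_starE a) piZ up_starE.
by congr (cls _); apply: familyP => j /=; rewrite starZ.
Qed.

Fact up_starM x y : up_star (x * y) = up_star y * up_star x.
Proof.
elim/quotW: x => a; elim/quotW: y => b;
rewrite (piM a b) (up_starE a) (up_starE b) piM up_starE.
by congr (cls _); apply: familyP => j /=; rewrite starM.
Qed.

Fact up_starK x : up_star (up_star x) = x.
Proof.
elim/quotW: x => a; rewrite (up_starE a) up_starE.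
by congr (cls _); apply: familyP => j /=; rewrite starK.
Qed.

Fact up_normD x y : up_norm (x + y) <= up_norm x + up_norm y.
Proof.
elim/quotW: x => a; elim/quotW: y => b; rewrite (piD a b) !up_normE.
rewrite -limD; [|exact: family_norm_cvg..].
apply: ultra_ler_lim; [exact: family_norm_cvg| |].
  by apply: is_cvgD; exact: family_norm_cvg.
by move=> j; exact: cnormD.
Qed.

Fact up_normZ (k : R[i]) x : up_norm (k *: x) = Normc.normc k * up_norm x.
Proof.
elim/quotW: x => a; rewrite (piZ k a) !up_normE; apply: cvg_lim => //=.
under eq_cvg do rewrite cnormZ.
by apply: cvgMl_tmp; exact: family_norm_cvg.
Qed.

Fact up_norm_eq0 x : up_norm x = 0 -> x = 0.
Proof.
elim/quotW: x => a; rewrite up_normE => a0; apply/up_eqP.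
have an : family_null a by rewrite /family_null -a0; exact: family_norm_cvg.
by apply: (@family_null_le _ _ 1) an => j /=; rewrite subr0 mul1r.
Qed.

Fact up_normM x y : up_norm (x * y) <= up_norm x * up_norm y.
Proof.
elim/quotW: x => a; elim/quotW: y => b; rewrite (piM a b) !up_normE.
rewrite -limM; [|exact: family_norm_cvg..].
apply: ultra_ler_lim; [exact: family_norm_cvg| |].
  by apply: is_cvgM; exact: family_norm_cvg.
by move=> j; exact: cnormM.
Qed.

Fact up_norm_star x : up_norm (up_star x * x) = up_norm x ^+ 2.
Proof.
elim/quotW: x => a; rewrite (up_starE a) piM !up_normE; apply: cvg_lim => //=.
under eq_cvg do rewrite cnorm_star expr2.
by rewrite expr2; apply: cvgM; exact: family_norm_cvg.
Qed.

Lemma up_norm_lt a (e : R) : up_norm (cls a) < e ->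
  \forall j \near U, cnorm (a j) < e.
Proof.
rewrite up_normE => ae.
have aN : cnorm (a j) @[j --> U] --> lim (cnorm (a j) @[j --> U]).
  exact: family_norm_cvg.
exact: (cvgr_lt _ aN).
Qed.

Lemma up_norm_le a (e : R) : (\forall j \near U, cnorm (a j) <= e) ->
  up_norm (cls a) <= e.
Proof.
move=> ae; rewrite up_normE; apply: limr_le ae; exact: family_norm_cvg.
Qed.

Fact up_complete (u : nat -> ultraproduct) :
  (forall e : R, 0 < e -> exists N : nat, forall m n : nat,
     (N <= m)%N -> (N <= n)%N -> up_norm (u m - u n) < e) ->
  exists l : ultraproduct, forall e : R, 0 < e -> exists N : nat,
    forall n : nat, (N <= n)%N -> up_norm (u n - l) < e.
Proof.
move=> cu; pose h n : R := 2^-1 ^+ n.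
have h0 n : 0 < h n by rewrite exprn_gt0 // invr_gt0.
have hS n : h n = h n.+1 *+ 2.
  by rewrite /h exprS -[RHS]mulr_natl mulrA divff ?mul1r // pnatr_eq0.
have /choice[N NP] n := cu _ (h0 n).
pose phi n := (\sum_(k < n.+1) N k)%N.
have phiN n : (N n <= phi n)%N by rewrite /phi big_ord_recr /= leq_addl.
have phiS n : (phi n <= phi n.+1)%N by rewrite /phi [leqRHS]big_ord_recr leq_addr.
pose v n : bounded_family := repr (u (phi n)).
have piv n : cls (v n) = u (phi n) by exact: reprK.
pose D n j := v n.+1 j - v n j.
have nearD n : \forall j \near U, cnorm (D n j) < h n.
  apply: (@up_norm_lt (family_add (v n.+1) (family_opp (v n)))).
  rewrite -piD -piN !piv; apply: NP => //.
  exact: leq_trans (phiN n) (phiS n).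
pose d n j := if cnorm (D n j) < h n then D n j else 0.
have dh n j : cnorm (d n j) <= h n.
  by rewrite /d; case: ifP => [/ltW//|_]; rewrite cnorm0 ltW.
pose s n j := v 0%N j + \sum_(k < n) d k j.
have sS n j : s n.+1 j - s n j = d n j.
  by rewrite /s big_ord_recr /= addrA [_ + d n j]addrC addrK.
have s_dist n p j : cnorm (s (n + p)%N j - s n j) <= h n *+ 2 - h (n + p)%N *+ 2.
  elim: p => [|p IH]; first by rewrite addn0 !subrr cnorm0.
  apply: le_trans (cdistD (s (n + p)%N j) _ _) _; rewrite addnS sS.
  apply: le_trans (lerD (dh _ _) IH) _.
  by rewrite addrC -addrA lerD2l -hS mulr2n opprD subrK.
have s_dist2 n m j : (n <= m)%N -> cnorm (s m j - s n j) <= h n *+ 2.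
  move=> nm; rewrite -(subnKC nm); apply: le_trans (s_dist _ _ _) _.
  by rewrite lerBlDr lerDl mulrn_wge0 // ltW.
have h_small (e : R) : 0 < e -> exists n, h n *+ 4 < e.
  move=> e0; have [n ne] := exists_half_exp (divr_gt0 e0 (ltr0n R 4)).
  by exists n; rewrite -mulr_natr -ltr_pdivlMr.
have s_cvg j : exists l : B j, forall n, cnorm (s n j - l) <= h n *+ 2.
  have [e /h_small[n ne]|l lP] := @cnorm_complete R (B j) (s^~ j).
    exists n => m p nm np; apply: le_lt_trans ne.
    apply: le_trans (cdistD (s n j) _ _) _.
    rewrite -[4%N]/(2 + 2)%N mulrnDr.
    by apply: lerD; [|rewrite cdistC]; exact: s_dist2.
  exists l => n; apply/ler_addgt0Pl => e /lP[k kP].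
  apply: le_trans (cdistD (s (maxn n k) j) _ _) _.
  rewrite [leRHS]addrC; apply: lerD; last by apply/ltW/kP/leq_maxr.
  by rewrite cdistC; apply/s_dist2/leq_maxl.
pose lv j := projT1 (cid (s_cvg j)).
have lvP j n : cnorm (s n j - lv j) <= h n *+ 2 := projT2 (cid (s_cvg j)) n.
have lv_bounded : exists M : R, forall j, cnorm (lv j) <= M.
  have [M vM] := family_bounded (v 0%N); exists (h 0%N *+ 2 + M) => j.
  rewrite -[lv j](subrK (s 0%N j)); apply: le_trans (cnormD _ _) _.
  by rewrite cdistC lerD //; rewrite /s big_ord0 addr0.
pose l := BoundedFamily lv_bounded.
have near_s n : \forall j \near U, s n j = v n j.
  elim: n => [|n IH]; first by apply: filterE => j; rewrite /s big_ord0 addr0.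
  apply: filterS2 IH (nearD n) => j sn Dn.
  by rewrite -[LHS](subrK (s n j)) sS /d Dn sn subrK.
exists (cls l) => e /h_small[n ne]; exists (N n) => m nm.
have norm_nl : up_norm (u (phi n) - cls l) <= h n *+ 2.
  rewrite -piv piN piD; apply: up_norm_le.
  by have := near_s n; apply: filterS => j /= <-; exact: lvP.
have -> : u m - cls l = (u m - u (phi n)) + (u (phi n) - cls l).
  by rewrite addrA subrK.
apply: le_lt_trans (up_normD _ _) _; apply: le_lt_trans ne.
rewrite -[4%N]/(2 + 2)%N mulrnDr lerD //.
by rewrite (le_trans (ltW (NP n m (phi n) nm (phiN n)))) // mulr2n lerDl ltW.
Qed.

HB.instance Definition _ := isCStarAlgebra.Build R ultraproduct
  up_starD up_starZ up_starM up_starK up_normD up_normZ up_norm_eq0 up_normM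
  up_norm_star up_complete.

End Ultraproduct.

Section ContinuousLogic.
Variable R : realType.

(* *-polynomials in [n] variables; [SOne] is the constant [I]. *)
Inductive star_poly (n : nat) : Type :=
| SVar of 'I_n
| SOne
| SAdd of star_poly n & star_poly n
| SMul of star_poly n & star_poly n
| SScale of R[i] & star_poly n
| SStar of star_poly n.

(* The free variables of [formula n] are indexed by ['I_n]; a quantifier binds
   the variable [ord0] of its body. *)
Inductive formula (n : nat) : Type :=
| FNorm of star_poly n
| FConnective (k : nat) (f : 'rV[R]_k -> R) of continuous f &
    ('I_k -> formula n)
| FSup of formula n.+1
| FInf of formula n.+1.

Definition sentence := formula 0.

Variable A : cstarAlgType R.

Fixpoint star_poly_eval n (t : star_poly n) (e : 'I_n -> A) : A :=
  match t with
  | SVar i => e i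
  | SOne => 1
  | SAdd t1 t2 => star_poly_eval t1 e + star_poly_eval t2 e
  | SMul t1 t2 => star_poly_eval t1 e * star_poly_eval t2 e
  | SScale k t1 => k *: star_poly_eval t1 e
  | SStar t1 => star (star_poly_eval t1 e)
  end.

Definition env_cons n (x : A) (e : 'I_n -> A) (i : 'I_n.+1) : A :=
  if unlift ord0 i is Some j then e j else x.

Definition unit_ball : set A := [set x | cnorm x <= 1].

(* The sets under [sup] and [inf] are nonempty and bounded, because formulae
   are bounded on bounded sets; the values of [sup] and [inf] on other sets
   are irrelevant. *)
Fixpoint formula_val n (phi : formula n) : ('I_n -> A) -> R :=
  match phi with
  | FNorm t => fun e => cnorm (star_poly_eval t e)
  | FConnective k f _ psi => fun e => f (\row_(i < k) formula_val (psi i) e)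
  | FSup psi => fun e => sup [set formula_val psi (env_cons x e) | x in unit_ball]
  | FInf psi => fun e => inf [set formula_val psi (env_cons x e) | x in unit_ball]
  end.

Definition sentence_val (phi : sentence) : R :=
  formula_val phi (fun i : 'I_0 => False_rect A (notF (ltn_ord i))).

End ContinuousLogic.

Definition elementarily_equivalent (R : realType) (A B : cstarAlgType R) : Prop :=
  forall phi : sentence R, sentence_val A phi = sentence_val B phi.

(* Only the *-algebra structures are compared: a *-isomorphism between
   C*-algebras is isometric, so the norm of [B] is then the operator norm.
   Matrices have size [n.+1], which is every size at least 1. *)
Definition matrix_algebra (R : realType) (B : cstarAlgType R) : Prop :=
  exists (n : nat) (f : {lrmorphism B -> 'M[R[i]]_n.+1}),
    (forall x, f (star x) = (map_mx Num.conj (f x))^T) /\ bijective f.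

(* Finite-dimensional C*-algebras in their classified form: nonempty finite
   direct sums of matrix algebras, up to *-isomorphism.
   [B] is *-isomorphic to the direct sum of the matrix algebras of sizes
   [(n i).+1] for [i : 'I_k.+1]: the [f i] are the components of the
   isomorphism, and the last clause is its bijectivity. *)
Definition finite_dimensional (R : realType) (B : cstarAlgType R) : Prop :=
  exists (k : nat) (n : 'I_k.+1 -> nat)
         (f : forall i : 'I_k.+1, {lrmorphism B -> 'M[R[i]]_((n i).+1)}),
    (forall i x, f i (star x) = (map_mx Num.conj (f i x))^T) /\
    (forall y : forall i : 'I_k.+1, 'M[R[i]]_((n i).+1),
       exists! x : B, forall i, f i x = y i).

Definition pseudomatricial (R : realType) (A : cstarAlgType R) : Prop :=
  exists (J : Type) (U : set_system J) (UF : UltraFilter U)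
         (B : J -> cstarAlgType R),
    (forall j, matrix_algebra (B j)) /\
    elementarily_equivalent A (ultraproduct UF B).

Definition pseudocompact (R : realType) (A : cstarAlgType R) : Prop :=
  exists (J : Type) (U : set_system J) (UF : UltraFilter U)
         (B : J -> cstarAlgType R),
    (forall j, finite_dimensional (B j)) /\
    elementarily_equivalent A (ultraproduct UF B).

Section Projections.
Variables (R : realType) (A : cstarAlgType R).

Definition projection (p : A) : Prop := star p = p /\ p * p = p.

Definition mutually_orthogonal (I : eqType) (e : I -> A) : Prop :=
  forall i j, i != j -> e i * e j = 0.

Definition mvn_equivalent (p q : A) : Prop :=
  exists v : A, p = star v * v /\ q = v * star v.

Definition subprojection (q p : A) : Prop := projection q /\ p * q = q.

Definition minimal_projection (p : A) : Prop :=
  [/\ projection p, p <> 0 & forall q, subprojection q p -> q = 0 \/ q = p].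

Definition abelian_projection (r : A) : Prop :=
  projection r /\ forall x y, (r * x * r) * (r * y * r) = (r * y * r) * (r * x * r).

End Projections.

(* Main.v *)
Require Import Defs.
From mathcomp Require Import all_boot all_order all_algebra.
From mathcomp Require Import complex.
From mathcomp Require Import boolp classical_sets reals.
From mathcomp Require Import topology normedtype.
From mathcomp Require Import ring lra zify.

Set Implicit Arguments.
Unset Strict Implicit.
Unset Printing Implicit Defensive.

Import Order.TTheory GRing.Theory Num.Theory.
Import numFieldNormedType.Exports.

Local Open Scope classical_set_scope.
Local Open Scope complex_scope.
Local Open Scope ring_scope.

(** The idea.  In the matrix algebra [M_n], write [n = q d + s] with [s < d].
The basis vectors split into [d] blocks of size [q], whose projections are
equivalent through partial permutation matrices, and [s <= d - 1] single
vectors, whose projections are minimal.  In a direct sum of matrix algebras the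
same is done in every summand; the sums of the rank one projections are then
abelian instead of minimal ([direct_sum_system]).  What has to be shown is that
such a system passes through the ultraproduct to every elementarily equivalent
algebra [A].

Elementary equivalence provides only approximate systems in [A]: the sentence
that takes the infimum of the defects of the relations has value [0], but the
infimum need not be attained ([approximate_transfer]).  Two facts repair this.

First, the relations between projections and partial isometries are stable:
approximate solutions are near exact ones.  A Newton-Schulz iteration corrects
one partial isometry, or one projection ([newton_schulz],
[projection_near]).  Approximate systems with defects tending to [0] make up
an exact system in an ultrapower of [A], where orthogonal projections can be
lifted one after the other by compressing to the complement of those already
lifted ([lift_orthogonal_projections]); this yields exact systems in [A]
([exact_system]).

Secondly, being minimal or zero, and being abelian, are consequences of
properties of the corner [r A r] that need only hold up to the error [1/2].
For minimality the property is multiplicativity of the norm on the corner,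
which is inherited from the scalars and leaves no room for two orthogonal
nonzero subprojections ([minimal_of_multiplicative_norm]).  For commutativity
it is the smallness of the commutators of contractions, which forces them to
vanish ([abelian_of_small_commutators]). *)

(** * Norm estimates *)

Section NormEstimates.
Variables (R : realType) (A : cstarAlgType R).
Implicit Types x y z p q : A.

Lemma cnormB x y : cnorm (x - y) <= cnorm x + cnorm y.
Proof. by rewrite -[cnorm y]cnormN; exact: cnormD. Qed.

Lemma starB x y : star (x - y) = star x - star y.
Proof. by rewrite starD starN. Qed.

Lemma star_sum (I : finType) (P : pred I) (F : I -> A) :
  star (\sum_(i | P i) F i) = \sum_(i | P i) star (F i).
Proof. by apply: (big_morph star (@starD R A)); exact: star0. Qed.

(** A projection satisfies [p = star p * p], so the C*-identity turns its norm
into an idempotent real number. *)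
Lemma cnorm_projection p : projection p -> cnorm p = 0 \/ cnorm p = 1.
Proof.
case=> ps pp; have := cnorm_star p; rewrite ps pp expr2 => /eqP.
rewrite -[X in X == _]mulr1 -subr_eq0 -mulrBr mulf_eq0 subr_eq0.
by case/orP=> /eqP <-; [left|right].
Qed.

Lemma cnorm_projection_le1 p : projection p -> cnorm p <= 1.
Proof. by case/cnorm_projection=> ->. Qed.

Lemma projection_eq0 p : projection p -> cnorm p < 1 -> p = 0.
Proof. by case/cnorm_projection=> [/cnorm_eq0 //|->]; rewrite ltxx. Qed.

Lemma projection_star_mul p : star p * p = p -> projection p.
Proof.
move=> pp; have ps : star p = p by rewrite -{1}pp starM starK pp.
by split; rewrite // -{1}ps.
Qed.

Lemma projection0 : projection (0 : A).
Proof. by split; rewrite ?star0 ?mulr0. Qed.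

Lemma projection1 : projection (1 : A).
Proof. by split; rewrite ?star1 ?mulr1. Qed.

Lemma projectionB p q : projection p -> projection q -> p * q = q ->
  projection (p - q).
Proof.
move=> [ps pp] [qs qq] pq; have qp : q * p = q by rewrite -ps -qs -starM pq.
by split; rewrite ?starB ?ps ?qs // mulrBl !mulrBr pp qq pq qp subrr subr0.
Qed.

Lemma projection_sum (I : finType) (e : I -> A) :
  (forall i, projection (e i)) -> mutually_orthogonal e ->
  projection (\sum_i e i).
Proof.
move=> ep eo; split; first by rewrite star_sum; apply: eq_bigr => i _; case: (ep i).
rewrite mulr_suml; apply: eq_bigr => i _; rewrite mulr_sumr (bigD1 i) //=.
rewrite big1 ?addr0; first by case: (ep i).
by move=> k ki; apply: eo; rewrite eq_sym.
Qed.

(** Multiplication is Lipschitz on the unit ball; iterating this bound compares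
any fixed word at two nearby points. *)
Lemma cnorm_mul_dist (a b c d : A) : cnorm b <= 1 -> cnorm c <= 1 ->
  cnorm (a * b - c * d) <= cnorm (a - c) + cnorm (b - d).
Proof.
move=> b1 c1.
have -> : a * b - c * d = (a - c) * b + c * (b - d).
  by rewrite mulrBl mulrBr addrA subrK.
apply: le_trans (cnormD _ _) _; apply: lerD; apply: le_trans (cnormM _ _) _.
  by rewrite ler_piMr // cnorm_ge0.
by rewrite ler_piMl // cnorm_ge0.
Qed.

Lemma cnormM_le1 x y : cnorm x <= 1 -> cnorm y <= 1 -> cnorm (x * y) <= 1.
Proof.
by move=> x1 y1; rewrite (le_trans (cnormM _ _)) // mulr_ile1 ?cnorm_ge0.
Qed.

Lemma eq_limit x y : (forall e : R, 0 < e -> cnorm (x - y) <= e) -> x = y.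
Proof.
move=> H; apply/eqP; rewrite -subr_eq0; apply/eqP/cnorm_eq0/le_anti.
rewrite cnorm_ge0 andbT; apply/ler_addgt0Pl => e e0.
by rewrite addr0; exact: H.
Qed.

Lemma normc_real (a : R) : 0 <= a -> Normc.normc a%:C = a.
Proof. by move=> a0; rewrite /Normc.normc /= expr0n addr0 sqrtr_sqr ger0_norm. Qed.

Lemma normc_half : Normc.normc (2^-1 : R[i]) = 2^-1.
Proof.
have -> : (2^-1 : R[i]) = (2^-1 : R)%:C by rewrite fmorphV /= rmorph_nat.
by rewrite normc_real // invr_ge0.
Qed.

Lemma cnorm_half x : cnorm (2^-1 *: x) = 2^-1 * cnorm x.
Proof. by rewrite cnormZ normc_half. Qed.

Lemma star_half x : star (2^-1 *: x) = 2^-1 *: star x.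
Proof. by rewrite starZ fmorphV rmorph_nat. Qed.

Lemma half_double x : 2^-1 *: x + 2^-1 *: x = x.
Proof.
have half : 2^-1 + 2^-1 = 1 :> R[i] by field.
by rewrite -scalerDl half scale1r.
Qed.

(** Completeness in the form used by the two approximation schemes below. *)
Lemma geometric_cvg (u : nat -> A) (c : R) : 0 <= c ->
  (forall k, cnorm (u k.+1 - u k) <= c * 2^-1 ^+ k) ->
  exists l, forall k, cnorm (l - u k) <= 2 * c * 2^-1 ^+ k.
Proof.
move=> c0 uS.
have h0 k : 0 < 2^-1 ^+ k :> R by rewrite exprn_gt0 // invr_gt0.
have hS k : 2^-1 ^+ k.+1 = 2^-1 * 2^-1 ^+ k :> R by rewrite exprS.
have dist n (p : nat) : cnorm (u (n + p)%N - u n)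
    <= 2 * c * 2^-1 ^+ n - 2 * c * 2^-1 ^+ (n + p).
  elim: p => [|p IH]; first by rewrite addn0 !subrr cnorm0 lexx.
  rewrite addnS; apply: le_trans (cdistD (u (n + p)%N) _ _) _.
  apply: le_trans (lerD (uS _) IH) _; rewrite hS.
  by have := h0 (n + p)%N; set w := 2^-1 ^+ (n + p); lra.
have dist2 n m : (n <= m)%N -> cnorm (u m - u n) <= 2 * c * 2^-1 ^+ n.
  move=> nm; rewrite -(subnKC nm); apply: le_trans (dist _ _) _.
  by rewrite lerBlDr lerDl !mulr_ge0 // ltW.
have small (e : R) : 0 < e -> exists n, 2 * c * 2^-1 ^+ n < e.
  move=> e0; have c1 : 0 < 2 * c + 1 by lra.
  have [n ne] := exists_half_exp (divr_gt0 e0 c1); exists n.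
  move: ne; rewrite ltr_pdivlMr // => ne; apply: le_lt_trans ne.
  by have := h0 n; set w := 2^-1 ^+ n; nra.
have [e e0|l lP] := @cnorm_complete R A u.
  have [n ne] := small _ (divr_gt0 e0 (ltr0n R 2)); exists n => m p nm np.
  apply: le_lt_trans (cdistD (u n) _ _) _; rewrite [e]splitr.
  by apply: ltrD; [|rewrite cdistC]; apply: le_lt_trans ne; exact: dist2.
exists l => k; apply/ler_addgt0Pl => e /lP[n nP].
apply: le_trans (cdistD (u (maxn n k)) _ _) _; apply: lerD.
  by rewrite cdistC; apply/ltW/nP/leq_maxl.
by apply: dist2; exact: leq_maxr.
Qed.

End NormEstimates.

(** * Perturbing approximate partial isometries and projections *)

Section NewtonSchulz.
Variables (R : realType) (A : cstarAlgType R).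
Implicit Types x y z p q b v h : A.

Definition newton_step p y := y + 2^-1 *: (y * (p - star y * y)).

(** With [h = p - star y * y] and [k = h / 2] the new defect is exactly
[3 k^2 + 2 k^3]: the first order terms cancel. *)
Lemma newton_step_defect p y : projection p -> y * p = y ->
  cnorm (p - star y * y) <= 2^-1 ->
  cnorm (p - star (newton_step p y) * newton_step p y)
    <= 2^-1 * cnorm (p - star y * y).
Proof.
move=> [ps pp] yp; rewrite /newton_step.
move hE : (p - star y * y) => h hle; pose k := 2^-1 *: h.
have py : p * star y = star y by rewrite -{1}ps -starM yp.
have hs : star h = h by rewrite -hE starB starM starK ps.
have ks : star k = k by rewrite star_half hs.
have ph : p * h = h by rewrite -hE mulrBr pp mulrA py.
have hp : h * p = h by rewrite -hs -{1}ps -starM ph hs.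
have pk : p * k = k by rewrite -scalerAr ph.
have kp : k * p = k by rewrite -scalerAl hp.
have yy : star y * y = p - (k + k) by rewrite half_double -hE subKr.
have -> : y + 2^-1 *: (y * h) = y * (1 + k) by rewrite mulrDr mulr1 -scalerAr.
have -> : star (y * (1 + k)) * (y * (1 + k)) = (1 + k) * (star y * y) * (1 + k).
  by rewrite starM starD star1 ks !mulrA.
rewrite yy.
have e1 : (1 + k) * (p - (k + k)) = p - k - (k * k + k * k).
  rewrite mulrDl mul1r !mulrBr !mulrDr kp !opprD !addrA.
  by rewrite subrK.
have e2 : (p - k - (k * k + k * k)) * (1 + k)
        = p - (k * k *+ 3 + k * k * k *+ 2).
  rewrite mulrDr mulr1 !mulrBl pk mulrDl.
  rewrite mulrSr !mulr2n !opprD !addrA.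
  by rewrite [_ - k * k + k]addrAC [_ - k * k + k]addrAC subrK.
rewrite e1 e2 subKr.
have kn : cnorm k = 2^-1 * cnorm h by rewrite cnorm_half.
have h0 : 0 <= cnorm h := cnorm_ge0 _.
have k2 : cnorm (k * k) <= cnorm k * cnorm k := cnormM _ _.
have k3 : cnorm (k * k * k) <= cnorm k * cnorm k * cnorm k.
  by apply: le_trans (cnormM _ _) _; rewrite ler_wpM2r ?cnorm_ge0.
apply: (@le_trans _ _ (cnorm k * cnorm k *+ 3 + cnorm k * cnorm k * cnorm k *+ 2)).
  rewrite !mulrS !mulr0n !addr0.
  do ![apply: le_trans (cnormD _ _) _; apply: lerD => //].
rewrite kn; move: (cnorm h) h0 hle => t t0 t1.
have : t * t <= 2^-1 * t by rewrite ler_wpM2r.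
have : t * t * t <= 2^-1 * (2^-1 * t).
  by rewrite -[t * t * t]mulrA ler_pM ?mulr_ge0 // ler_wpM2r.
nra.
Qed.

Lemma newton_step_star p q y : projection p -> projection q ->
  q * y = y -> y * p = y ->
  star (newton_step p y) = newton_step q (star y).
Proof.
move=> [ps _] [qs _] qy yp; rewrite /newton_step starD star_half starM starB.
have py : p * star y = star y by rewrite -{1}ps -starM yp.
have yq : star y * q = star y by rewrite -{1}qs -starM qy.
by rewrite starM !starK ps mulrBl mulrBr py yq mulrA.
Qed.

Lemma cnorm_near_isometry p y : projection p -> cnorm (p - star y * y) <= 2^-1 ->
  cnorm y <= 2.
Proof.
move=> /cnorm_projection_le1 p1 hle.
have : cnorm y ^+ 2 <= 1 + 2^-1.
  rewrite -cnorm_star; have -> : star y * y = p - (p - star y * y).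
    by rewrite subKr.
  by apply: le_trans (cnormB _ _) _; apply: lerD.
by rewrite expr2 => ?; have := cnorm_ge0 y; nra.
Qed.

Lemma newton_step_dist p y : projection p -> cnorm (p - star y * y) <= 2^-1 ->
  cnorm (newton_step p y - y) <= cnorm (p - star y * y).
Proof.
move=> pp hle; have y2 := cnorm_near_isometry pp hle.
rewrite /newton_step addrC addKr cnorm_half.
have := cnormM y (p - star y * y); have := cnorm_ge0 (p - star y * y).
by nra.
Qed.

Lemma cnorm_star_mul_dist x y : cnorm x <= 2 -> cnorm y <= 3 ->
  cnorm (star x * x - star y * y) <= 5 * cnorm (x - y).
Proof.
move=> x2 y3.
have -> : star x * x - star y * y = star (x - y) * x + star y * (x - y).
  by rewrite starB mulrBl mulrBr addrA subrK.
have := cnormD (star (x - y) * x) (star y * (x - y)).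
have := cnormM (star (x - y)) x; have := cnormM (star y) (x - y).
rewrite !cnormS; have := cnorm_ge0 (x - y); nra.
Qed.

Lemma isometry_absorb p z : projection p -> star z * z = p -> z * p = z.
Proof.
move=> [ps pp] zz; apply/esym/eqP; rewrite -subr_eq0; apply/eqP/cnorm_eq0/eqP.
rewrite -sqrf_eq0 -cnorm_star starB starM ps mulrBl !mulrBr.
by rewrite -!mulrA (mulrA (star z)) !zz pp pp !subrr cnorm0.
Qed.

(** Newton-Schulz iteration for the polar decomposition: every step at least
halves the defects [p - star y * y] and [q - y * star y] and moves [y] by no
more than the first one, so the iterates converge to a partial isometry from
[p] to [q].  For [p = q] and [y] self-adjoint the step is [(3 y - y^3) / 2], a
real polynomial in [y], whence the last clause. *)
Lemma newton_schulz p q y (d : R) : projection p -> projection q ->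
  q * y = y -> y * p = y -> d <= 2^-1 ->
  cnorm (p - star y * y) <= d -> cnorm (q - y * star y) <= d ->
  exists z, [/\ star z * z = p, z * star z = q, cnorm (z - y) <= 2 * d
    & p = q -> star y = y -> star z = z].
Proof.
move=> pP qP qy yp d2 hd gd.
have d0 : 0 <= d := le_trans (cnorm_ge0 _) hd.
pose u k := iter k (newton_step p) y.
have h0 k : 0 < 2^-1 ^+ k :> R by rewrite exprn_gt0 // invr_gt0.
have hS k : 2^-1 ^+ k.+1 = 2^-1 * 2^-1 ^+ k :> R by rewrite exprS.
have h1 k : 2^-1 ^+ k <= 1 :> R by apply: exprn_ile1; lra.
have dk k : d * 2^-1 ^+ k <= 2^-1 by have := h0 k; have := h1 k; nra.
have uP k : [/\ q * u k = u k, u k * p = u k,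
    cnorm (p - star (u k) * u k) <= d * 2^-1 ^+ k
    & cnorm (q - u k * star (u k)) <= d * 2^-1 ^+ k].
  elim: k => [|k [qu up hu gu]]; first by rewrite expr0 mulr1.
  have us : star (u k.+1) = newton_step q (star (u k)).
    exact: newton_step_star.
  have [[ps pp] [qs qq]] := (pP, qP).
  split.
  - by rewrite /= /newton_step mulrDr qu -scalerAr mulrA qu.
  - rewrite /= /newton_step mulrDl up -scalerAl -mulrA mulrBl pp.
    by rewrite -[_ * u k * p]mulrA up.
  - apply: le_trans (newton_step_defect pP up (le_trans hu (dk k))) _.
    by rewrite hS; lra.
  - rewrite us -[X in X * _]starK us.
    apply: le_trans (newton_step_defect qP _ _) _; rewrite ?starK.
    + by rewrite -{1}qs -starM qu.
    + exact: le_trans gu (dk k).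
    + by rewrite hS; lra.
have [|z zP] := @geometric_cvg _ _ u d d0.
  move=> k; have [_ _ hu _] := uP k.
  exact: le_trans (newton_step_dist pP (le_trans hu (dk k))) hu.
have zy : cnorm (z - y) <= 2 * d by have := zP 0%N; rewrite expr0 mulr1.
have u2 k : cnorm (u k) <= 2.
  have [_ _ hu _] := uP k; exact: cnorm_near_isometry pP (le_trans hu (dk k)).
have z3 : cnorm z <= 3.
  by rewrite -[z](subrK y); have := cnormD (z - y) y; have := u2 0%N => /=; lra.
have small (e : R) : 0 < e -> exists k, 11 * d * 2^-1 ^+ k <= e.
  move=> e0; have [k ke] := exists_half_exp (divr_gt0 e0 (ltr0n R 11)).
  by exists k; move: ke; rewrite ltr_pdivlMr //; have := h0 k; nra.
exists z; split=> //.
- apply/esym/eq_limit => e /small[k]; apply: le_trans.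
  have [_ _ hu _] := uP k.
  apply: le_trans (cdistD (star (u k) * u k) _ _) _.
  have := cnorm_star_mul_dist (u2 k) z3; rewrite [cnorm (u k - z)]cdistC.
  by have := zP k; lra.
- apply/esym/eq_limit => e /small[k]; apply: le_trans.
  have [_ _ _ hu] := uP k.
  apply: le_trans (cdistD (u k * star (u k)) _ _) _.
  have := @cnorm_star_mul_dist (star (u k)) (star z).
  rewrite !starK !cnormS -starB cnormS => /(_ (u2 k) z3).
  by rewrite [cnorm (u k - z)]cdistC; have := zP k; lra.
- move=> pq ys; have us k : star (u k) = u k.
    elim: k => [//|k IH] /=; have [qu up _ _] := uP k.
    by rewrite (newton_step_star pP qP) // IH pq.
  apply: eq_limit => e /small[k]; apply: le_trans.
  apply: le_trans (cdistD (u k) _ _) _; rewrite -{1}us -starB cnormS.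
  by rewrite [cnorm (u k - z)]cdistC; have := zP k; have := h0 k; nra.
Qed.

(** The symmetry [2 g - f] of a projection [g <= f] is a self-adjoint partial
isometry from [f] to [f], so the iteration applied to [2 b - f] produces [g].
When [b * b - b] is not small, [g = 0] satisfies the same linear bound. *)
Lemma projection_near f b : projection f -> star b = b -> f * b = b ->
  exists g, [/\ projection g, f * g = g & cnorm (g - b) <= 16 * cnorm (b * b - b)].
Proof.
move=> fP bs fb; have [fs ff] := fP.
have bf : b * f = b by rewrite -bs -{1}fs -starM fb bs.
have t0 := cnorm_ge0 (b * b - b).
have [tle|tgt] := leP (cnorm (b * b - b)) (8^-1); last first.
  (* Since [|b|^2 <= |b| + t] with [t > 1/8], either [|b| <= 2 <= 16 t] or
     [|b| <= t]. *)
  exists 0; split; [exact: projection0|exact: mulr0|].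
  rewrite sub0r cnormN.
  have : cnorm b ^+ 2 <= cnorm b + cnorm (b * b - b).
    by rewrite -cnorm_star bs -{1}[b * b](subrK b) addrC cnormD.
  by rewrite expr2; have := cnorm_ge0 b; nra.
pose y := b + b - f.
have ys : star y = y by rewrite starB starD bs fs.
have fy : f * y = y by rewrite mulrBr mulrDr fb ff.
have yf : y * f = y by rewrite mulrBl mulrDl bf ff.
have yyE : f - y * y = - ((b * b - b) *+ 4).
  have -> : y * y = (b * b - b) *+ 4 + f.
    have yb : b * y = b * b + b * b - b by rewrite mulrBr mulrDr bf.
    rewrite {1}/y mulrBl fy mulrDl yb /y !mulrS mulr0n addr0.
    rewrite !opprD opprK !addrA.
    by rewrite [LHS](AC 9 (1*3*2*6*4*7*5*8*9)).
  by rewrite opprD addrCA subrr addr0.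
have yyle : cnorm (f - y * y) <= 4 * cnorm (b * b - b).
  rewrite yyE cnormN !mulrS mulr0n addr0.
  have := cnormD (b * b - b) (b * b - b + (b * b - b + (b * b - b))).
  have := cnormD (b * b - b) (b * b - b + (b * b - b)).
  by have := cnormD (b * b - b) (b * b - b); lra.
have yysle : cnorm (f - star y * y) <= 4 * cnorm (b * b - b) by rewrite ys.
have [||z [zz _ zy zs]] := newton_schulz fP fP fy yf _ yysle; rewrite ?ys //.
  by lra.
have {}zs : star z = z by exact: zs.
have {}zz : z * z = f by rewrite -{1}zs.
have zf : z * f = z by apply: isometry_absorb; rewrite // zs.
have fz : f * z = z by rewrite -zs -{1}fs -starM zf.
exists (2^-1 *: (f + z)); split.
- split; first by rewrite star_half starD fs zs.
  rewrite -scalerAl -scalerAr mulrDl !mulrDr ff fz zf zz [z + f]addrC.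
  by rewrite scalerDr half_double.
- by rewrite -scalerAr mulrDr ff fz.
- have -> : 2^-1 *: (f + z) - b = 2^-1 *: (z - y).
    rewrite -{1}[b]half_double -scalerDr -scalerBr; congr (_ *: _).
    by rewrite /y opprB addrCA addrA.
  by rewrite cnorm_half; lra.
Qed.

Lemma mvn_equivalent_near p q w : projection p -> projection q ->
  let y := q * w * p in
  cnorm (p - star y * y) <= 2^-1 -> cnorm (q - y * star y) <= 2^-1 ->
  mvn_equivalent p q.
Proof.
move=> pP qP y yp yq; have [[_ pp] [_ qq]] := (pP, qP).
have [||z [zz zzs _ _]] := newton_schulz pP qP _ _ (lexx _) yp yq.
- by rewrite /y !mulrA qq.
- by rewrite /y -mulrA pp.
by exists z; rewrite zz zzs.
Qed.

End NewtonSchulz.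

(** * Small commutators and almost multiplicative norms in a corner *)

Section Gaps.
Variables (R : realType) (A : cstarAlgType R).
Implicit Types x y z p q r u w h a : A.

Lemma neumann_inverse a : cnorm a <= 2^-1 ->
  exists w, (1 - a) * w = 1 /\ w * (1 - a) = 1.
Proof.
move=> a2; pose s k := \sum_(i < k) a ^+ i.
have h0 k : 0 < 2^-1 ^+ k :> R by rewrite exprn_gt0 // invr_gt0.
have ak k : cnorm (a ^+ k) <= 2^-1 ^+ k.
  elim: k => [|k IH]; first by rewrite !expr0 cnorm1.
  rewrite !exprS; apply: le_trans (cnormM _ _) _.
  by apply: ler_pM; rewrite ?cnorm_ge0.
have [|w wP] := @geometric_cvg _ _ s 1 ler01.
  by move=> k; rewrite /s big_ord_recr /= addrAC subrr add0r mul1r.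
have sl k : (1 - a) * s k = 1 - a ^+ k.
  elim: k => [|k IH]; first by rewrite /s big_ord0 mulr0 expr0 subrr.
  rewrite /s big_ord_recr /= mulrDr IH mulrBl mul1r -exprS.
  by rewrite addrA subrK.
have sr k : s k * (1 - a) = 1 - a ^+ k.
  elim: k => [|k IH]; first by rewrite /s big_ord0 mul0r expr0 subrr.
  rewrite /s big_ord_recr /= mulrDl IH mulrBr mulr1 -exprSr.
  by rewrite addrA subrK.
have n1a : cnorm (1 - a) <= 2.
  by have := cnormB 1 a; rewrite cnorm1; lra.
have small (e : R) : 0 < e -> exists k, 5 * 2^-1 ^+ k <= e.
  move=> e0; have [k ke] := exists_half_exp (divr_gt0 e0 (ltr0n R 5)).
  by exists k; move: ke; rewrite ltr_pdivlMr //; lra.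
exists w; split; apply: eq_limit => e /small[k]; apply: le_trans.
- apply: le_trans (cdistD ((1 - a) * s k) _ _) _; rewrite -mulrBr sl.
  rewrite [_ - 1]addrAC subrr add0r cnormN.
  have := cnormM (1 - a) (w - s k); have := wP k; have := ak k.
  by have := cnorm_ge0 (w - s k); have := cnorm_ge0 (1 - a); nra.
- apply: le_trans (cdistD (s k * (1 - a)) _ _) _; rewrite -mulrBl sr.
  rewrite [_ - 1]addrAC subrr add0r cnormN.
  have := cnormM (w - s k) (1 - a); have := wP k; have := ak k.
  by have := cnorm_ge0 (w - s k); have := cnorm_ge0 (1 - a); nra.
Qed.

Definition imag : R[i] := 0 +i* 1.

Lemma imagM : imag * imag = -1.
Proof. by rewrite /imag; apply/eqP; rewrite eq_complex /=; apply/andP; split; apply/eqP; ring. Qed.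

Lemma normc_imag : Normc.normc imag = 1.
Proof. by rewrite /imag /= expr0n expr1n add0r sqrtr1. Qed.

Lemma star_imag x : star (imag *: x) = - (imag *: star x).
Proof.
rewrite starZ -scaleNr; congr (_ *: _).
by apply/eqP; rewrite eq_complex /= oppr0 !eqxx.
Qed.

Lemma imagK x : imag *: (imag *: x) = - x.
Proof. by rewrite scalerA imagM scaleN1r. Qed.

Section Corner.
Variable r : A.
Hypothesis rP : projection r.

Definition unitary_commutant u :=
  [/\ star u * u = 1, u * star u = 1 & u * r = r * u].

Definition commutator_bound (s : R) := forall u x,
  unitary_commutant u -> r * x * r = x -> cnorm (u * x - x * u) <= s * cnorm x.

Lemma cnorm_unitary u : star u * u = 1 -> cnorm u <= 1.
Proof.
move=> uu; have := cnorm_star u; rewrite uu cnorm1 expr2.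
by have := cnorm_ge0 u; nra.
Qed.

Lemma corner_absorb x : r * x * r = x -> r * x = x /\ x * r = x.
Proof.
by have [_ rr] := rP; move=> <-; rewrite !mulrA rr -!mulrA rr.
Qed.

(** This is [2 (g - 1) = (g^2 - 1) - (g - 1)^2] for the operator [g = Ad u].  Put
[c = u x - x u].  Then [2 c u = (u^2 x - x u^2) - (u c - c u)], where
both commutators are bounded by hypothesis and [c] is itself small. *)
Lemma commutator_bound_improve (s : R) : 0 <= s -> commutator_bound s ->
  commutator_bound (2^-1 * (s + s * s)).
Proof.
move=> s0 H u x uP xr; have [uu uus ur] := uP; have [rx xr'] := corner_absorb xr.
have u1 := cnorm_unitary uu.
pose c := u * x - x * u.
have cr : r * c * r = c.
  rewrite /c mulrBr mulrBl -!mulrA xr' ur (mulrA x r) xr' (mulrA r u) -ur.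
  by rewrite -(mulrA u) rx (mulrA r) rx.
have u2P : unitary_commutant (u * u).
  split; rewrite ?starM.
  - by rewrite mulrA -[star u * star u * u]mulrA uu mulr1.
  - by rewrite mulrA -[u * u * star u]mulrA uus mulr1.
  - by rewrite -mulrA ur mulrA ur -mulrA.
have cE : c * u + c * u = (u * u * x - x * (u * u)) - (u * c - c * u).
  rewrite /c !mulrBl !mulrBr !mulrA !opprB !addrA.
  by rewrite [RHS](AC 6 ((3*2*5*4)*(1*6))) /= subrr addr0.
have cu : cnorm c <= cnorm (c * u).
  rewrite -{1}[c]mulr1 -uus mulrA; apply: le_trans (cnormM _ _) _.
  by rewrite cnormS ler_piMr // cnorm_ge0.
have c1 := H _ _ uP xr; have c2 := H _ _ u2P xr; have c3 := H _ _ uP cr.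
have : cnorm (c * u) *+ 2 <= s * cnorm x + s * cnorm c.
  have -> : cnorm (c * u) *+ 2 = cnorm (c * u + c * u).
    rewrite -{1}[c * u]half_double -scalerDr cnorm_half -mulrnAl.
    by rewrite -mulr_natr mulVf ?mul1r // pnatr_eq0.
  rewrite cE; apply: le_trans (cnormB _ _) _; exact: lerD.
by rewrite -/c in c1 *; move: (cnorm_ge0 x); nra.
Qed.

Lemma commutator_bound_le (s t : R) : s <= t ->
  commutator_bound s -> commutator_bound t.
Proof.
move=> st H u x uP xr; apply: le_trans (H u x uP xr) _.
by rewrite ler_wpM2r // cnorm_ge0.
Qed.

Lemma commutator_bound_halve (s : R) : 0 <= s -> s <= 2^-1 ->
  commutator_bound s -> commutator_bound (2^-1 * s).
Proof.
have step t : 0 <= t -> t <= 2^-1 -> commutator_bound t ->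
    commutator_bound (3 / 4 * t).
  move=> t0 t2 /(commutator_bound_improve t0); apply: commutator_bound_le.
  by nra.
move=> s0 s2 Hs.
apply: (@commutator_bound_le (3 / 4 * (3 / 4 * (3 / 4 * s)))); first by lra.
by do 3![apply: (step _); [lra|lra|]].
Qed.

Lemma commutator_bound0 u x : commutator_bound 2^-1 ->
  unitary_commutant u -> r * x * r = x -> u * x = x * u.
Proof.
move=> H uP xr.
have Hk k : commutator_bound (2^-1 ^+ k.+1).
  elim: k => [|k IH]; first by rewrite expr1.
  have k1 : 2^-1 ^+ k <= 1 :> R by apply: exprn_ile1; lra.
  have k0 : 0 <= 2^-1 ^+ k :> R by apply: exprn_ge0; lra.
  by rewrite exprS; apply: commutator_bound_halve; rewrite // exprS; lra.
apply: eq_limit => e e0.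
have x0 : 0 < cnorm x + 1 by rewrite ltr_wpDl // cnorm_ge0.
have [k] := exists_half_exp (divr_gt0 e0 x0); rewrite ltr_pdivlMr // => ke.
apply: le_trans (Hk k u x uP xr) _; rewrite exprS.
have := cnorm_ge0 x; have : 0 < 2^-1 ^+ k :> R by rewrite exprn_gt0 // invr_gt0.
by nra.
Qed.

(** The Cayley transform [u = (1 + i h) / (1 - i h)] of a small self-adjoint
[h] is unitary, and [h] is recovered from it: [u + 1 = 2 / (1 - i h)]. *)
Lemma cayley_commute h x : commutator_bound 2^-1 ->
  star h = h -> r * h * r = h -> cnorm h <= 2^-1 -> r * x * r = x ->
  h * x = x * h.
Proof.
move=> H hs hr h2 xr.
pose a := imag *: h; have [rh hr'] := corner_absorb hr.
have as_ : star a = - a by rewrite star_imag hs.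
have [|w [aw wa]] := @neumann_inverse a; first by rewrite cnormZ normc_imag mul1r.
have wsE : star w * (1 + a) = 1 /\ (1 + a) * star w = 1.
  have <- : star (1 - a) = 1 + a by rewrite starB star1 as_ opprK.
  by rewrite -!starM aw wa star1.
have aC : (1 - a) * (1 + a) = (1 + a) * (1 - a).
  rewrite mulrDr mulr1 mulrBl mul1r mulrBr mulr1 mulrDl mul1r.
  by rewrite opprD !addrA subrK addrK.
have [wsl wsr] := wsE.
have wC : (1 + a) * w = w * (1 + a).
  rewrite -[LHS]mul1r -{1}wa -!mulrA [(1 - a) * _]mulrA aC.
  by rewrite -mulrA aw mulr1.
have ar : a * r = r * a by rewrite -scalerAl -scalerAr rh hr'.
have wr : w * r = r * w.
  have ar1 : (1 - a) * r = r * (1 - a) by rewrite mulrBl mulrBr mul1r mulr1 ar.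
  by rewrite -[LHS]mulr1 -aw mulrA -[w * r * _]mulrA -ar1 mulrA wa mul1r.
pose u := (1 + a) * w.
have us : star u = star w * (1 - a) by rewrite starM starD star1 as_.
have uP : unitary_commutant u.
  split.
  - rewrite us /u -mulrA [(1 - a) * _]mulrA aC -!mulrA aw mulr1 //.
  - by rewrite us /u wC -mulrA [(1 + a) * _]mulrA wsr mul1r.
  - rewrite /u -mulrA wr !mulrA; congr (_ * _).
    by rewrite mulrDl mulrDr mul1r mulr1 ar.
have ux := commutator_bound0 H uP xr.
have wu : u + 1 = w + w.
  rewrite -{1}aw /u -mulrDl; have -> : 1 + a + (1 - a) = 1 + 1.
    by rewrite addrACA subrr addr0.
  by rewrite mulrDl mul1r.
have wx : w * x = x * w.
  rewrite -[w]half_double -scalerDr -wu -scalerAl -scalerAr.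
  by rewrite mulrDl mulrDr mul1r mulr1 ux.
have ax : (1 - a) * x = x * (1 - a).
  by rewrite -[LHS]mulr1 -{2}wa mulrA -[_ * x * w]mulrA -wx mulrA aw mul1r.
have {}ax : a * x = x * a.
  by apply: oppr_inj; apply: (addrI x); move: ax; rewrite mulrBl mulrBr mul1r mulr1.
apply: oppr_inj; rewrite -!imagK; congr (_ *: _).
by rewrite scalerAl ax -scalerAr.
Qed.

(** A noncommutative corner contains unit vectors whose commutator has norm
bounded below: the operators [Ad u] for unitaries [u] of the corner form a
group, and in a Banach algebra a group contained in a ball of radius less than
[1] about the identity is trivial.  So commutators of norm at most [1/2] make
every unitary of the corner central, and the corner is spanned by them. *)
Lemma abelian_of_small_commutators :
  (forall x y, cnorm x <= 1 -> cnorm y <= 1 ->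
    cnorm ((r * x * r) * (r * y * r) - (r * y * r) * (r * x * r)) <= 2^-1) ->
  abelian_projection r.
Proof.
move=> H; split=> //; have [rs rr] := rP.
have H2 : commutator_bound 2^-1.
  move=> u x [uu _ ur] xr; have [rx xr'] := corner_absorb xr.
  have [/cnorm_eq0->|x0] := eqVneq (cnorm x) 0.
    by rewrite mulr0 mul0r subrr !cnorm0 mulr0.
  pose k : R[i] := (cnorm x)^-1%:C.
  have kn : Normc.normc k = (cnorm x)^-1 by rewrite normc_real // invr_ge0 cnorm_ge0.
  have := H u (k *: x) (cnorm_unitary uu); rewrite cnormZ kn mulVf // lexx => /(_ isT).
  rewrite -!(scalerAr, scalerAl) -scalerBr cnormZ kn xr.
  have -> : r * u * r * x = u * x by rewrite -mulrA rx -ur -mulrA rx.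
  have -> : x * (r * u * r) = x * u by rewrite !mulrA xr' -mulrA ur mulrA xr'.
  by rewrite mulrC ler_pdivrMr // lt_neqAle eq_sym x0 cnorm_ge0.
have corner x : r * (r * x * r) * r = r * x * r.
  by rewrite !mulrA rr -mulrA rr.
have sa h x : star h = h -> r * h * r = h -> r * x * r = x -> h * x = x * h.
  move=> hs hr xr; pose t : R := (2 * (cnorm h + 1))^-1.
  have h0 := cnorm_ge0 h.
  have t0 : 0 < t by rewrite invr_gt0; lra.
  have tn : t * (2 * (cnorm h + 1)) = 1 by rewrite mulVf // gt_eqF //; lra.
  pose k : R[i] := t%:C.
  have k0 : k != 0 by rewrite /k fmorph_eq0 gt_eqF.
  apply: (scalerI k0); rewrite scalerAl scalerAr.
  apply: cayley_commute => //.
  - rewrite starZ hs; congr (_ *: _).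
    by apply/eqP; rewrite eq_complex /= oppr0 !eqxx.
  - by rewrite -scalerAr -scalerAl hr.
  - by rewrite cnormZ normc_real ?ltW //; nra.
move=> x y; move: (r * x * r) (r * y * r) (corner x) (corner y) => {}x {}y xr yr.
have xsr : r * star x * r = star x by rewrite -{1 2}rs -!starM mulrA xr.
have re : (x + star x) * y = y * (x + star x).
  apply: sa => //; first by rewrite starD starK addrC.
  by rewrite mulrDr mulrDl xr xsr.
have im : (imag *: (x - star x)) * y = y * (imag *: (x - star x)).
  apply: sa => //; first by rewrite star_imag starB starK -scalerN opprB.
  by rewrite -scalerAr -scalerAl mulrBr mulrBl xr xsr.
have {}im : (x - star x) * y = y * (x - star x).
  apply: oppr_inj; rewrite -[LHS]imagK -[RHS]imagK; congr (_ *: _).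
  by rewrite scalerAl im -scalerAr.
have -> : x = 2^-1 *: ((x + star x) + (x - star x)).
  by rewrite addrACA subrr addr0 scalerDr half_double.
by rewrite -scalerAl -scalerAr mulrDl mulrDr re im.
Qed.

(** Norms of projections are 0 or 1, so [q * (r - q) = 0] contradicts an almost
multiplicative norm unless [q] or [r - q] vanishes. *)
Lemma minimal_of_multiplicative_norm :
  (forall x y, cnorm x <= 1 -> cnorm y <= 1 ->
    `|cnorm ((r * x * r) * (r * y * r)) - cnorm (r * x * r) * cnorm (r * y * r)|
      <= 2^-1) ->
  minimal_projection r \/ r = 0.
Proof.
move=> H; have [->|r0] := eqVneq r 0; [by right|left]; split=> //; first exact/eqP.
move=> q [qP rq]; have [[rs rr] [qs qq]] := (rP, qP).
have rqP : projection (r - q) by exact: projectionB.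
have qr : q * r = q by rewrite -qs -{1}rs -starM rq.
have := H q (r - q) (cnorm_projection_le1 qP) (cnorm_projection_le1 rqP).
have -> : r * (r - q) * r = r - q by rewrite mulrBr rr rq mulrBl rr qr.
rewrite rq qr mulrBr qr qq subrr cnorm0 sub0r normrN.
case: (cnorm_projection qP) => [/cnorm_eq0->|->]; first by left.
case: (cnorm_projection rqP) => [/cnorm_eq0/eqP|->].
  by rewrite subr_eq0 => /eqP->; right.
by rewrite mulr1 normr1 leNgt invf_lt1 ?ltr1n ?ltr0n.
Qed.

End Corner.
End Gaps.

(** * Lifting projections from an ultraproduct *)

Section Lifting.
Variables (R : realType) (J : Type) (U : set_system J).
Hypothesis UF : UltraFilter U.
Variable B : J -> cstarAlgType R.
Local Open Scope quotient_scope.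
Local Notation P := (ultraproduct UF B).
Local Notation cls := (\pi_(ultraproduct UF B)).
Implicit Types (a b c F : bounded_family B) (x y : P).

Lemma eq_cls a b : (forall j, a j = b j) -> cls a = cls b.
Proof. by move=> ab; congr (cls _); exact: Defs.familyP. Qed.

Lemma cls_near a b (e : R) : cls a = cls b -> 0 < e ->
  \forall j \near U, cnorm (a j - b j) < e.
Proof. by move=> /up_eqP/family_nullP ab /ab. Qed.

Lemma cls_star a : star (cls a) = cls (family_star a).
Proof. exact: up_starE. Qed.

Lemma cls_norm a : cnorm (cls a) = lim (cnorm (a j) @[j --> U]).
Proof. exact: up_normE. Qed.

Lemma cls_norm_le a (M : R) : (forall j, cnorm (a j) <= M) -> cnorm (cls a) <= M.
Proof. by move=> aM; apply: up_norm_le; apply: filterE. Qed.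

Lemma cls_norm_cvg a : cnorm (a j) @[j --> U] --> cnorm (cls a).
Proof. by rewrite cls_norm; exact: family_norm_cvg. Qed.

Lemma cls1 : cls (family_one B) = 1.
Proof. by []. Qed.

Lemma cls0 : cls (family_zero B) = 0.
Proof. by []. Qed.

Lemma cls_sum (T : finType) (g : T -> bounded_family B) F :
  (forall j, F j = \sum_t g t j) -> cls F = \sum_t cls (g t).
Proof.
move=> FE; rewrite -(big_morph cls (fun a b => esym (piD UF a b)) (erefl _)).
apply: eq_cls => j; rewrite FE.
by rewrite (@big_morph _ _ (fun a : bounded_family B => a j) 0 +%R).
Qed.

(** The compression to [F] of the self-adjoint part of any representative of
[x] is almost idempotent along [U], hence near a projection below [F]; the
linear estimate of [projection_near] needs no case distinction on [j]. *)
Lemma lift_subprojection F x : (forall j, projection (F j)) -> projection x ->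
  cls F * x = x ->
  exists g : bounded_family B,
    (forall j, projection (g j) /\ F j * g j = g j) /\ cls g = x.
Proof.
move=> FP [xs xx] Fx.
have Fs : star (cls F) = cls F.
  by rewrite cls_star; apply: eq_cls => j; case: (FP j).
have xF : x * cls F = x by rewrite -xs -Fs -starM Fx.
pose a := repr x; have ax : cls a = x by exact: reprK.
pose b := family_mul (family_mul F
  (family_scale 2^-1 (family_add a (family_star a)))) F.
have bx : cls b = x.
  by rewrite -!piM -piZ -piD -cls_star ax xs scalerDr half_double Fx xF.
have gP j : exists g : B j, [/\ projection g, F j * g = g
    & cnorm (g - b j) <= 16 * cnorm (b j * b j - b j)].
  have [Fjs Fj2] := FP j; apply: projection_near => //.
    by rewrite /= !starM star_half starD starK Fjs mulrA [star _ + _]addrC.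
  by rewrite /= !mulrA Fj2.
have gM : exists M : R, forall j, cnorm (projT1 (cid (gP j))) <= M.
  by exists 1 => j; apply: cnorm_projection_le1; case: (projT2 (cid (gP j))).
exists (BoundedFamily gM); split=> [j|] /=; first by case: (projT2 (cid (gP j))).
rewrite -bx; apply: (@up_eq_dist _ _ _ _ _ (family_mul b b) b _ _ 16).
  by move=> j /=; case: (projT2 (cid (gP j))).
by rewrite -piM bx xx.
Qed.

(** Induction on the set of indices already treated, with [0] at the others: the
next projection is lifted below the complement of the sum of the previous
lifts, which keeps the lifts orthogonal in every coordinate. *)
Lemma lift_orthogonal_projections (T : finType) (x : T -> P) :
  (forall t, projection (x t)) -> mutually_orthogonal x ->
  exists g : T -> bounded_family B, (forall t, cls (g t) = x t) /\
    forall j, (forall t, projection (g t j)) /\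
      mutually_orthogonal (fun t => g t j).
Proof.
move=> xP xo.
suff H (s : seq T) : exists g : T -> bounded_family B,
    (forall t, cls (g t) = if t \in s then x t else 0) /\
    forall j, (forall t, projection (g t j)) /\
      mutually_orthogonal (fun t => g t j).
  by have [g [gx gP]] := H (enum T); exists g; split=> // t; rewrite gx mem_enum.
elim: s => [|t s [g [gx gP]]].
  exists (fun=> family_zero B); split=> // j; split=> [t|t t' _] /=.
    exact: projection0.
  exact: mulr0.
have [ts|ts] := boolP (t \in s).
  by exists g; split=> // t'; rewrite gx inE; case: eqVneq => // ->; rewrite ts.
have sumP j : projection (\sum_t' g t' j).
  by have [gPj goj] := gP j; exact: projection_sum.
have FP j : projection (1 - \sum_t' g t' j).
  by apply: projectionB; [exact: projection1|exact: sumP|exact: mul1r].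
have FM : exists M : R, forall j, cnorm (1 - \sum_t' g t' j) <= M.
  by exists 1 => j; exact: cnorm_projection_le1.
have SM : exists M : R, forall j, cnorm (\sum_t' g t' j) <= M.
  by exists 1 => j; exact: cnorm_projection_le1.
pose F := BoundedFamily FM; pose S := BoundedFamily SM.
have Fx : cls F * x t = x t.
  have -> : cls F = 1 - cls S by rewrite -cls1 piN piD; exact: eq_cls.
  rewrite (@cls_sum _ g) // mulrBl mul1r mulr_suml big1 ?subr0 // => t' _.
  rewrite gx; case: ifP => [ts'|_]; last by rewrite mul0r.
  by apply: xo; apply: contraNneq ts => <-.
have [h [hP hx]] := @lift_subprojection F (x t) FP (xP t) Fx.
exists (fun t' => if t' == t then h else g t'); split=> [t'|j].
  by rewrite inE; case: eqVneq => [->|_].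
have [gPj goj] := gP j; have [hPj Fh] := hP j.
have gh t' : g t' j * h j = 0.
  rewrite -Fh mulrA mulrBr mulr1 mulr_sumr (bigD1 t') //= big1 ?addr0.
    by case: (gPj t') => _ ->; rewrite subrr mul0r.
  by move=> t'' tt; apply: goj; rewrite eq_sym.
have hg t' : h j * g t' j = 0.
  have [hs _] := hPj; have [gs _] := gPj t'.
  by rewrite -hs -gs -starM gh star0.
split=> [t'|t1 t2 ne /=]; first by case: eqVneq.
case: (eqVneq t1 t) => [t1t|_]; case: (eqVneq t2 t) => [t2t|_] //; last exact: goj.
by rewrite t1t t2t eqxx in ne.
Qed.

(** Compressing a representative of [x] to [b] and [a] gives, along [U], an
approximate partial isometry, which the Newton-Schulz iteration makes exact. *)
Lemma lift_mvn_equivalent a b x :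
  (forall j, projection (a j)) -> (forall j, projection (b j)) ->
  star x * x = cls a -> x * star x = cls b ->
  \forall j \near U, mvn_equivalent (a j) (b j).
Proof.
move=> aP bP xa xb.
pose w := repr x; have wx : cls w = x by exact: reprK.
pose y := family_mul (family_mul b w) a.
have aa : projection (cls a).
  split; first by rewrite cls_star; apply: eq_cls => j; case: (aP j).
  by rewrite piM; apply: eq_cls => j; case: (aP j).
have xabs : x * cls a = x by exact: isometry_absorb.
have yx : cls y = x by rewrite -!piM wx -xb -[x * star x * x]mulrA xa !xabs.
have ya : cls a = cls (family_mul (family_star y) y).
  by rewrite -piM -cls_star yx xa.
have yb : cls b = cls (family_mul y (family_star y)).
  by rewrite -piM -cls_star yx xb.
have h0 : 0 < 2^-1 :> R by rewrite invr_gt0.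
apply: filterS2 (cls_near ya h0) (cls_near yb h0) => j /= /ltW aj /ltW bj.
exact: mvn_equivalent_near aj bj.
Qed.

End Lifting.

(** * Approximate transfer along elementary equivalence *)

Section Formulas.
Variable R : realType.

Definition sum_row k (v : 'rV[R]_k) : R := \sum_(i < k) v ord0 i.

Lemma sum_row_continuous k : continuous (@sum_row k).
Proof.
apply: continuous_big => [|i _]; first exact: add_continuous.
exact: coord_continuous.
Qed.

Definition fsum n (K : finType) (psi : K -> formula R n) : formula R n :=
  FConnective (@sum_row_continuous #|K|) (fun i => psi (enum_val i)).

(** The truncation at [1] keeps the suprema below finite whatever the
polynomials are. *)
Definition product_gap (v : 'rV[R]_3) : R :=
  Num.min 1 `|v ord0 (inord 0) - v ord0 (inord 1) * v ord0 (inord 2)|.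

Lemma product_gap_continuous : continuous product_gap.
Proof.
move=> v; rewrite /product_gap.
pose g (w : 'rV[R]_3) : R := `|w ord0 (inord 0) - w ord0 (inord 1) * w ord0 (inord 2)|.
apply: (@continuous_min R _ (fun=> 1) g v); first exact: cst_continuous.
have c i : (fun w : 'rV[R]_3 => w ord0 i) @ v --> v ord0 i.
  exact: coord_continuous.
exact: (cvg_norm (cvgB (c _) (cvgM (c _) (c _)))).
Qed.

(** In [t1], [t2] and [t3] the variable [lift ord0 ord0] belongs to the outer
supremum and [ord0] to the inner one. *)
Definition fgap n (t1 t2 t3 : star_poly R n.+2) : formula R n :=
  FSup (FSup (FConnective product_gap_continuous
    (fun i => FNorm (tnth [tuple t1; t2; t3] i)))).

Fixpoint finfs n : formula R n -> sentence R :=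
  match n with
  | 0 => id
  | m.+1 => fun phi => finfs (FInf phi)
  end.

Section Values.
Variable A : cstarAlgType R.
Implicit Types (x y : A).

Lemma unit_ball0 : unit_ball (0 : A).
Proof. by rewrite /unit_ball /= cnorm0. Qed.

Lemma fsum_val_le n (K : finType) (psi : K -> formula R n) (e : 'I_n -> A) k :
  (forall k', 0 <= formula_val (psi k') e) ->
  formula_val (psi k) e <= formula_val (fsum psi) e.
Proof.
move=> psi0; rewrite /= /sum_row (bigD1 (enum_rank k)) //= mxE enum_rankK lerDl.
by apply: sumr_ge0 => i _; rewrite mxE.
Qed.

Lemma fsum_val_ge0 n (K : finType) (psi : K -> formula R n) (e : 'I_n -> A) :
  (forall k, 0 <= formula_val (psi k) e) -> 0 <= formula_val (fsum psi) e.
Proof. by move=> psi0; apply: sumr_ge0 => i _; rewrite mxE. Qed.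

Lemma fsum_val_eq0 n (K : finType) (psi : K -> formula R n) (e : 'I_n -> A) :
  (forall k, formula_val (psi k) e = 0) -> formula_val (fsum psi) e = 0.
Proof. by move=> psi0; apply: big1 => i _; rewrite mxE. Qed.

Lemma fsup_val n (psi : formula R n.+1) (e : 'I_n -> A) (c : R) :
  (forall x, 0 <= formula_val psi (env_cons x e) <= 1) ->
  [/\ 0 <= formula_val (FSup psi) e <= 1,
      forall x, cnorm x <= 1 -> formula_val psi (env_cons x e) <= formula_val (FSup psi) e
    & (forall x, cnorm x <= 1 -> formula_val psi (env_cons x e) <= c) ->
      formula_val (FSup psi) e <= c].
Proof.
move=> psi01; set E := [set formula_val psi (env_cons x e) | x in @unit_ball R A].
have E0 : E !=set0 by exists (formula_val psi (env_cons 0 e)), 0 => //; exact: unit_ball0.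
have E1 : has_ubound E by exists 1 => _ [x _ <-]; case/andP: (psi01 x).
have le_sup x : cnorm x <= 1 -> formula_val psi (env_cons x e) <= sup E.
  by move=> x1; apply: ub_le_sup => //; exists x.
split=> //.
- apply/andP; split.
    by apply: le_trans (le_sup 0 unit_ball0); case/andP: (psi01 0).
  by apply: ge_sup => // _ [x _ <-]; case/andP: (psi01 x).
- by move=> psic; apply: ge_sup => // _ [x x1 <-]; exact: psic.
Qed.

Definition gap n (t1 t2 t3 : star_poly R n) (e : 'I_n -> A) : R :=
  `|cnorm (star_poly_eval t1 e)
    - cnorm (star_poly_eval t2 e) * cnorm (star_poly_eval t3 e)|.

Lemma product_gap_val n (t1 t2 t3 : star_poly R n) (e : 'I_n -> A) :
  formula_val (FConnective product_gap_continuous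
    (fun i => FNorm (tnth [tuple t1; t2; t3] i))) e = Num.min 1 (gap t1 t2 t3 e).
Proof. by rewrite /= /product_gap !mxE !(tnth_nth t1) !inordK. Qed.

Lemma fgap_val n (t1 t2 t3 : star_poly R n.+2) (e : 'I_n -> A) :
  [/\ 0 <= formula_val (fgap t1 t2 t3) e,
      forall x y, cnorm x <= 1 -> cnorm y <= 1 ->
        Num.min 1 (gap t1 t2 t3 (env_cons y (env_cons x e)))
          <= formula_val (fgap t1 t2 t3) e
    & (forall x y, gap t1 t2 t3 (env_cons y (env_cons x e)) = 0) ->
      formula_val (fgap t1 t2 t3) e = 0].
Proof.
rewrite /fgap; set psi := FConnective _ _.
have psi01 (e' : 'I_n.+2 -> A) : 0 <= formula_val psi e' <= 1.
  by rewrite product_gap_val le_min ler01 normr_ge0 ge_min lexx.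
have S1 x c := @fsup_val _ psi (env_cons x e) c (fun y => psi01 _).
have S2 c := @fsup_val _ (FSup psi) e c
  (fun x => let: And3 H _ _ := S1 x 0 in H).
have [/andP[ge0 _] le_sup sup_le] := S2 0.
split=> //.
- move=> x y x1 y1; rewrite -product_gap_val -/psi.
  apply: le_trans (le_sup x x1); have [_ H _] := S1 x 0; exact: H.
- move=> gap0; apply/le_anti; rewrite ge0 andbT; apply: sup_le => x x1.
  have [_ _] := S1 x 0; apply => y y1.
  by rewrite /psi product_gap_val gap0 ge_min lexx orbT.
Qed.

Lemma env_cons_split n (e : 'I_n.+1 -> A) :
  e = env_cons (e ord0) (fun i => e (lift ord0 i)).
Proof.
apply: functional_extensionality_dep => i; rewrite /env_cons.
by case: unliftP => [j|] ->.
Qed.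

Lemma finf_val_ge0 n (phi : formula R n.+1) (e : 'I_n -> A) :
  (forall e' : 'I_n.+1 -> A, 0 <= formula_val phi e') -> 0 <= formula_val (FInf phi) e.
Proof.
move=> phi0; apply: lb_le_inf; last by move=> _ [x _ <-].
by exists (formula_val phi (env_cons 0 e)), 0 => //; exact: unit_ball0.
Qed.

Lemma finfs_val_ge0 n (phi : formula R n) :
  (forall e : 'I_n -> A, 0 <= formula_val phi e) -> 0 <= sentence_val A (finfs phi).
Proof.
elim: n phi => [|n IH] phi phi0; first exact: phi0.
by apply: IH => e; exact: finf_val_ge0.
Qed.

Lemma finfs_val_le n (phi : formula R n) (e : 'I_n -> A) :
  (forall e', 0 <= formula_val phi (e' : 'I_n -> A)) -> (forall i, cnorm (e i) <= 1) ->
  sentence_val A (finfs phi) <= formula_val phi e.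
Proof.
elim: n phi e => [|n IH] phi e phi0 e1.
  rewrite le_eqVlt; apply/orP; left; apply/eqP; congr (formula_val _ _).
  by apply: functional_extensionality_dep => -[].
rewrite /= [e in leRHS]env_cons_split.
apply: le_trans (IH (FInf phi) (fun i => e (lift ord0 i)) _ _) _ => //.
  by move=> e'; exact: finf_val_ge0.
apply: ge_inf; first by exists 0 => _ [x _ <-].
by exists (e ord0) => //; exact: e1.
Qed.

Lemma finfs_val_lt n (phi : formula R n) (c : R) :
  (forall e', 0 <= formula_val phi (e' : 'I_n -> A)) ->
  sentence_val A (finfs phi) < c ->
  exists e : 'I_n -> A, (forall i, cnorm (e i) <= 1) /\ formula_val phi e < c.
Proof.
elim: n phi => [|n IH] phi phi0 phic; first by eexists; split; [case|exact: phic].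
have [e [e1]] := IH _ (fun e => finf_val_ge0 e phi0) phic.
rewrite /= => vallt; have [|_ [x x1 <-] xc] := inf_lt _ vallt.
  by exists (formula_val phi (env_cons 0 e)), 0 => //; exact: unit_ball0.
exists (env_cons x e); split=> // i.
by rewrite /env_cons; case: unliftP.
Qed.

End Values.
End Formulas.

Section PolynomialsInUltraproducts.
Variables (R : realType) (J : Type) (U : set_system J).
Hypothesis UF : UltraFilter U.
Variable B : J -> cstarAlgType R.
Local Open Scope quotient_scope.
Local Notation cls := (\pi_(ultraproduct UF B)).

Lemma cls_star_poly_eval n (t : star_poly R n) (a : 'I_n -> bounded_family B) :
  exists b : bounded_family B,
    (forall j, b j = star_poly_eval t (fun i => a i j)) /\
    cls b = star_poly_eval t (fun i => cls (a i)).
Proof.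
elim: t => [i||t [b [bE bc]] s [c [cE cc]]|t [b [bE bc]] s [c [cE cc]]
    |k t [b [bE bc]]|t [b [bE bc]]] /=.
- by exists (a i).
- by exists (family_one B).
- exists (family_add b c); split=> [j|]; first by rewrite /= bE cE.
  by rewrite -piD bc cc.
- exists (family_mul b c); split=> [j|]; first by rewrite /= bE cE.
  by rewrite -piM bc cc.
- exists (family_scale k b); split=> [j|]; first by rewrite /= bE.
  by rewrite -piZ bc.
- exists (family_star b); split=> [j|]; first by rewrite /= bE.
  by rewrite -cls_star bc.
Qed.

(** Norms in the ultraproduct are limits of norms in the factors, and limits
respect products. *)
Lemma ultraproduct_gap0 n (t1 t2 t3 : star_poly R n) (a : 'I_n -> bounded_family B) :
  (forall j, gap t1 t2 t3 (fun i => a i j) = 0) ->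
  gap t1 t2 t3 (fun i => cls (a i)) = 0.
Proof.
move=> gap0; rewrite /gap.
have [b1 [b1E <-]] := cls_star_poly_eval t1 a.
have [b2 [b2E <-]] := cls_star_poly_eval t2 a.
have [b3 [b3E <-]] := cls_star_poly_eval t3 a.
apply/eqP; rewrite normr_eq0 subr_eq0; apply/eqP.
rewrite [LHS]cls_norm; apply: cvg_lim => //.
have -> : (fun j => cnorm (b1 j)) = (fun j => cnorm (b2 j) * cnorm (b3 j)).
  apply: functional_extensionality_dep => j; apply/eqP.
  by rewrite -subr_eq0 -normr_eq0 b1E b2E b3E; apply/eqP; exact: gap0.
by apply: cvgM; exact: cls_norm_cvg.
Qed.

End PolynomialsInUltraproducts.

(** The sentence [inf_e (sum_k |rel_k(e)| + sum_l sup_x sup_y gap_l(e, x, y))]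
has value [0] in the ultraproduct, where the infimum is attained, hence value
[0] in [A]. *)
Theorem approximate_transfer (R : realType) (A : cstarAlgType R)
    (J : Type) (U : set_system J) (UF : UltraFilter U) (B : J -> cstarAlgType R)
    (n : nat) (K L : finType) (rel : K -> star_poly R n)
    (t1 t2 t3 : L -> star_poly R n.+2) (a : forall j, 'I_n -> B j) (eps : R) :
  elementarily_equivalent A (ultraproduct UF B) ->
  (forall j i, cnorm (a j i) <= 1) ->
  (forall j k, star_poly_eval (rel k) (a j) = 0) ->
  (forall j l x y, gap (t1 l) (t2 l) (t3 l) (env_cons y (env_cons x (a j))) = 0) ->
  0 < eps -> eps <= 1 ->
  exists e : 'I_n -> A, [/\ forall i, cnorm (e i) <= 1,
    forall k, cnorm (star_poly_eval (rel k) e) < eps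
    & forall l x y, cnorm x <= 1 -> cnorm y <= 1 ->
      gap (t1 l) (t2 l) (t3 l) (env_cons y (env_cons x e)) < eps].
Proof.
move=> AP a1 rel0 gap0 eps0 eps1.
pose psi (m : K + L) := match m with
  | inl k => FNorm (rel k) | inr l => fgap (t1 l) (t2 l) (t3 l) end.
have psi_ge0 (D : cstarAlgType R) (e : 'I_n -> D) m : 0 <= formula_val (psi m) e.
  case: m => [k|l] /=; first exact: cnorm_ge0.
  by have [] := fgap_val (t1 l) (t2 l) (t3 l) e.
have sum_ge0 (D : cstarAlgType R) (e : 'I_n -> D) : 0 <= formula_val (fsum psi) e.
  exact: fsum_val_ge0.
have aM i : exists M : R, forall j, cnorm (a j i) <= M by exists 1.
pose fam i : bounded_family B := BoundedFamily (aM i).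
pose ca i : ultraproduct UF B := (\pi_(ultraproduct UF B) (fam i))%qT.
have P0 : sentence_val (ultraproduct UF B) (finfs (fsum psi)) = 0.
  apply/le_anti/andP; split; last exact: finfs_val_ge0.
  have ca1 i : cnorm (ca i) <= 1 by apply: cls_norm_le => j; exact: a1.
  apply: le_trans (finfs_val_le (sum_ge0 _) ca1) _.
  rewrite fsum_val_eq0 // => -[k|l]; last first.
    have [_ _ gapP] := fgap_val (t1 l) (t2 l) (t3 l) ca.
    apply: gapP => x y.
    pose fam' : 'I_n.+2 -> bounded_family B := fun i =>
      if unlift ord0 i is Some i' then
        if unlift ord0 i' is Some i'' then fam i'' else repr x
      else repr y.
    have -> : env_cons y (env_cons x ca)
        = fun i => (\pi_(ultraproduct UF B) (fam' i))%qT.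
      apply: functional_extensionality_dep => i; rewrite /env_cons /fam'.
      by case: unliftP => [i' _|_]; [case: unliftP => [i'' _|_]|]; rewrite ?reprK.
    apply: ultraproduct_gap0 => j; rewrite -[RHS](gap0 j l (repr x j) (repr y j)).
    congr gap; apply: functional_extensionality_dep => i; rewrite /env_cons /fam'.
    by case: unliftP => [i' _|_ //]; case: unliftP.
  have [b [bE]] := cls_star_poly_eval UF (rel k) fam.
  rewrite /= => <-.
  have -> : (\pi_(ultraproduct UF B) b)%qT = 0.
    by rewrite -cls0; apply: eq_cls => j; rewrite bE rel0.
  exact: cnorm0.
have [|e [e1 eeps]] := @finfs_val_lt _ A _ (fsum psi) eps (sum_ge0 _).
  by rewrite AP P0.
have small m : formula_val (psi m) e < eps.
  by apply: le_lt_trans eeps; exact: fsum_val_le.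
exists e; split=> // [k|l x y x1 y1]; first exact: (small (inl k)).
have [_ gle _] := fgap_val (t1 l) (t2 l) (t3 l) e.
have := le_lt_trans (gle x y x1 y1) (small (inr l)).
by rewrite gt_min ltNge eps1.
Qed.

(** * Systems of projections and their stability *)

Section Systems.
Variables (R : realType) (d : nat).
Local Notation T := ('I_d + 'I_d.-1)%type.
Local Notation V := (T + 'I_d * 'I_d)%type.
Local Notation N := #|{: V}|.

Definition system (A : cstarAlgType R) (e : T -> A) (v : 'I_d * 'I_d -> A) : Prop :=
  [/\ forall t, star (e t) * e t = e t, mutually_orthogonal e, \sum_t e t = 1,
      forall i, star (v i) * v i = e (inl i.1)
    & forall i, v i * star (v i) = e (inl i.2)].

Definition assignment (A : Type) (e : T -> A) (v : 'I_d * 'I_d -> A) (i : 'I_N) : A :=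
  match enum_val i with inl t => e t | inr p => v p end.

Definition var (x : V) : star_poly R N := SVar R (enum_rank x).
Definition ssub n (s t : star_poly R n) := SAdd s (SScale (-1) t).
Definition szero n : star_poly R n := SScale 0 (SOne R n).
Definition ssum (s : seq T) : star_poly R N :=
  foldr (fun t acc => SAdd (var (inl t)) acc) (szero N) s.

Definition relation_index : finType :=
  (T + T * T + unit + 'I_d * 'I_d + 'I_d * 'I_d)%type.

Definition relation (k : relation_index) : star_poly R N :=
  match k with
  | inl (inl (inl (inl t))) =>
      ssub (SMul (SStar (var (inl t))) (var (inl t))) (var (inl t))
  | inl (inl (inl (inr (t, t')))) =>
      if t == t' then szero N else SMul (var (inl t)) (var (inl t'))
  | inl (inl (inr _)) => ssub (ssum (enum {: T})) (SOne R N)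
  | inl (inr i) =>
      ssub (SMul (SStar (var (inr i))) (var (inr i))) (var (inl (inl i.1)))
  | inr i =>
      ssub (SMul (var (inr i)) (SStar (var (inr i)))) (var (inl (inl i.2)))
  end.

Section Evaluation.
Variables (A : cstarAlgType R) (e : T -> A) (v : 'I_d * 'I_d -> A).

Lemma assignment_rank (x : V) :
  assignment e v (enum_rank x) = match x with inl t => e t | inr p => v p end.
Proof. by rewrite /assignment enum_rankK. Qed.

Lemma ssub_eval n (s t : star_poly R n) (w : 'I_n -> A) :
  star_poly_eval (ssub s t) w = star_poly_eval s w - star_poly_eval t w.
Proof. by rewrite /= scaleN1r. Qed.

Lemma ssum_eval : star_poly_eval (ssum (enum {: T})) (assignment e v) = \sum_t e t.
Proof.
rewrite -big_enum /=; elim: (enum _) => [|t s IH]; first by rewrite big_nil /= scale0r.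
by rewrite big_cons /= assignment_rank; congr (_ + _).
Qed.

Lemma systemP : system e v <->
  forall k, star_poly_eval (relation k) (assignment e v) = 0.
Proof.
split=> [[ee eo e1 ve vv] [[[[t|[t t']]|u]|i]|i]|rel0].
- by rewrite ssub_eval /= assignment_rank ee subrr.
- rewrite /=; case: eqVneq => [_|ne]; first by rewrite /= scale0r.
  by rewrite /= !assignment_rank; exact: eo.
- by rewrite ssub_eval ssum_eval e1 subrr.
- by rewrite ssub_eval /= !assignment_rank ve subrr.
- by rewrite ssub_eval /= !assignment_rank vv subrr.
split.
- move=> t; have := rel0 (inl (inl (inl (inl t)))).
  by rewrite ssub_eval /= assignment_rank => /eqP; rewrite subr_eq0 => /eqP.
- move=> t t' ne; have := rel0 (inl (inl (inl (inr (t, t'))))).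
  by rewrite /= (negbTE ne) /= !assignment_rank.
- have := rel0 (inl (inl (inr tt))).
  by rewrite ssub_eval ssum_eval => /eqP; rewrite subr_eq0 => /eqP.
- move=> i; have := rel0 (inl (inr i)).
  by rewrite ssub_eval /= !assignment_rank => /eqP; rewrite subr_eq0 => /eqP.
- move=> i; have := rel0 (inr i).
  by rewrite ssub_eval /= !assignment_rank => /eqP; rewrite subr_eq0 => /eqP.
Qed.

Lemma system_norm_le1 : system e v -> forall i, cnorm (assignment e v i) <= 1.
Proof.
move=> [ee _ _ ve _] i; rewrite /assignment; case: (enum_val i) => [t|p].
  exact/cnorm_projection_le1/projection_star_mul.
have : cnorm (v p) ^+ 2 <= 1.
  by rewrite -cnorm_star ve; exact/cnorm_projection_le1/projection_star_mul.
by rewrite expr_le1 // cnorm_ge0.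
Qed.

End Evaluation.

(** The two properties imposed on the corner at [r].  Each makes sense in the
form of a norm equality between *-polynomials in [r] and two elements of the
unit ball, and a defect at most [1/2] is already decisive. *)
Variant corner_law := Multiplicative | Commutative.

Definition corner_gap (law : corner_law) (A : cstarAlgType R) (r x y : A) : R :=
  let a := r * x * r in let b := r * y * r in
  match law with
  | Multiplicative => `|cnorm (a * b) - cnorm a * cnorm b|
  | Commutative => cnorm (a * b - b * a)
  end.

Definition corner (j : 'I_d.-1) (z : 'I_N.+2) : star_poly R N.+2 :=
  let r := SVar R (lift ord0 (lift ord0 (enum_rank (inl (inr j) : V)))) in
  SMul (SMul r (SVar R z)) r.

Definition corner_gap_terms (law : corner_law) (j : 'I_d.-1) :=
  let a := corner j (lift ord0 ord0) in let b := corner j ord0 in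
  match law with
  | Multiplicative => (SMul a b, a, b)
  | Commutative => (ssub (SMul a b) (SMul b a), szero N.+2, szero N.+2)
  end.

Lemma corner_gap_eval law (A : cstarAlgType R) (e : T -> A) v j (x y : A) :
  gap (corner_gap_terms law j).1.1 (corner_gap_terms law j).1.2
    (corner_gap_terms law j).2 (env_cons y (env_cons x (assignment e v)))
  = corner_gap law (e (inr j)) x y.
Proof.
set E := env_cons y _.
have Er : E (lift ord0 (lift ord0 (enum_rank (inl (inr j) : V)))) = e (inr j).
  by rewrite /E /env_cons !liftK assignment_rank.
have Ex : E (lift ord0 ord0) = x by rewrite /E /env_cons liftK unlift_none.
have Ey : E ord0 = y by rewrite /E /env_cons unlift_none.
have cE z : star_poly_eval (corner j z) E = e (inr j) * E z * e (inr j).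
  by rewrite /= Er.
have mE s t : star_poly_eval (SMul s t) E = star_poly_eval s E * star_poly_eval t E.
  by [].
case: law; rewrite /gap; cbn [corner_gap_terms fst snd].
  by rewrite (mE (corner j _)) !cE Ex Ey.
rewrite ssub_eval [star_poly_eval (szero _) E]/= scale0r cnorm0 mulr0 subr0.
by rewrite ger0_norm ?cnorm_ge0 // !(mE (corner j _)) !cE Ex Ey.
Qed.

(** The gap of a corner survives the replacement of an approximate projection by
the exact one nearby. *)
Lemma corner_gap_lipschitz law (A : cstarAlgType R) (r s x y : A) :
  cnorm r <= 1 -> cnorm s <= 1 -> cnorm x <= 1 -> cnorm y <= 1 ->
  corner_gap law s x y <= corner_gap law r x y + 8 * cnorm (r - s).
Proof.
move=> r1 s1 x1 y1.
have comp z : cnorm z <= 1 -> cnorm (r * z * r - s * z * s) <= 2 * cnorm (r - s).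
  move=> z1; apply: le_trans (cnorm_mul_dist _ _ r1 (cnormM_le1 s1 z1)) _.
  have := cnorm_mul_dist r z z1 s1; rewrite subrr cnorm0; lra.
have n1 (q z : A) : cnorm q <= 1 -> cnorm z <= 1 -> cnorm (q * z * q) <= 1.
  by move=> q1 z1; do !apply: cnormM_le1.
rewrite /corner_gap.
have := comp _ x1; have := comp _ y1.
have := n1 _ _ r1 x1; have := n1 _ _ r1 y1.
have := n1 _ _ s1 x1; have := n1 _ _ s1 y1.
move: (r * x * r) (r * y * r) (s * x * s) (s * y * s) => a b a' b'.
move=> b'1 a'1 b1 a1 bb aa.
have ab : cnorm (a * b - a' * b') <= 4 * cnorm (r - s).
  by apply: le_trans (cnorm_mul_dist _ _ b1 a'1) _; lra.
have ba : cnorm (b * a - b' * a') <= 4 * cnorm (r - s).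
  by apply: le_trans (cnorm_mul_dist _ _ a1 b'1) _; lra.
case: law.
  have nab := cdist_dist (a * b) (a' * b').
  have na := cdist_dist a a'; have nb := cdist_dist b b'.
  have nn : `|cnorm a * cnorm b - cnorm a' * cnorm b'| <= 4 * cnorm (r - s).
    have -> : cnorm a * cnorm b - cnorm a' * cnorm b'
      = (cnorm a - cnorm a') * cnorm b + cnorm a' * (cnorm b - cnorm b') by ring.
    apply: le_trans (ler_normD _ _) _; rewrite !normrM.
    rewrite (ger0_norm (cnorm_ge0 b)) (ger0_norm (cnorm_ge0 a')).
    have : `|cnorm a - cnorm a'| * cnorm b <= `|cnorm a - cnorm a'|.
      by rewrite ler_piMr.
    have : cnorm a' * `|cnorm b - cnorm b'| <= `|cnorm b - cnorm b'|.
      by rewrite ler_piMl.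
    lra.
  have -> : cnorm (a' * b') - cnorm a' * cnorm b'
    = (cnorm (a * b) - cnorm a * cnorm b) - (cnorm (a * b) - cnorm (a' * b'))
      + (cnorm a * cnorm b - cnorm a' * cnorm b') by ring.
  apply: le_trans (ler_normD _ _) _.
  apply: le_trans (lerD (ler_normB _ _) (lexx _)) _.
  by lra.
have -> : a' * b' - b' * a'
    = (a * b - b * a) - ((a * b - a' * b') - (b * a - b' * a')).
  rewrite !opprB !addrA.
  by rewrite [RHS](AC 6 (5*4*(3*2)*(1*6))) /= !subrr !addr0.
apply: le_trans (cnormB _ _) _; rewrite lerD2l.
by apply: le_trans (cnormB _ _) _; lra.
Qed.

(** Approximate systems of defect [2^-n] form an exact system in an ultrapower
of [A] along a free ultrafilter on the natural numbers.  Its projections lift,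
so some approximate system is close to an exact one. *)
Theorem exact_system (A : cstarAlgType R) (law : corner_law) :
  (forall eps : R, 0 < eps -> eps <= 1 -> exists w : 'I_N -> A,
    [/\ forall i, cnorm (w i) <= 1,
        forall k, cnorm (star_poly_eval (relation k) w) < eps
      & forall j x y, cnorm x <= 1 -> cnorm y <= 1 ->
        gap (corner_gap_terms law j).1.1 (corner_gap_terms law j).1.2
          (corner_gap_terms law j).2 (env_cons y (env_cons x w)) < eps]) ->
  exists e : T -> A,
    [/\ forall t, projection (e t), mutually_orthogonal e, \sum_t e t = 1,
        forall i i', mvn_equivalent (e (inl i)) (e (inl i'))
      & forall j x y, cnorm x <= 1 -> cnorm y <= 1 ->
        corner_gap law (e (inr j)) x y <= 2^-1].
Proof.
move=> approx.
have eps0 n : 0 < 2^-1 ^+ n :> R by rewrite exprn_gt0 // invr_gt0.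
have eps1 n : 2^-1 ^+ n <= 1 :> R by apply: exprn_ile1; lra.
have /choice[w wP] n := approx _ (eps0 n) (eps1 n).
have [U [UF Uoo]] := ultraFilterLemma eventually_filter.
have near_small (c : R) : 0 < c -> \forall n \near U, 2^-1 ^+ n < c.
  move=> c0; apply: Uoo; have [n nc] := exists_half_exp c0.
  exists n => // m /= nm; apply: le_lt_trans nc.
  rewrite -(subnKC nm) exprD ler_piMr //; exact: ltW.
have wM i : exists M : R, forall n : nat, cnorm (w n i) <= M.
  by exists 1 => n; have [] := wP n.
pose fam i : bounded_family (fun _ : nat => A) := BoundedFamily (wM i).
pose cl i : ultraproduct UF (fun=> A) :=
  (\pi_(ultraproduct UF (fun=> A)) (fam i))%qT.
pose ce t := cl (enum_rank (inl t : V)); pose cv p := cl (enum_rank (inr p : V)).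
have clE : cl = assignment ce cv.
  apply: functional_extensionality_dep => i; rewrite /assignment /ce /cv.
  by case E : (enum_val i) => [t|p]; rewrite -E enum_valK.
have /systemP[ee eo e1 ve vv] : forall k,
    star_poly_eval (relation k) (assignment ce cv) = 0.
  move=> k; rewrite -clE.
  have [b [bE <-]] := cls_star_poly_eval UF (relation k) fam.
  rewrite -cls0; apply/up_eqP/family_nullP => c c0.
  apply: filterS (near_small c c0) => n /= nc; rewrite subr0 bE.
  by apply: lt_trans nc; have [_ relP _] := wP n; exact: relP.
have ep t : projection (ce t) by exact: projection_star_mul.
have [g [gc gP]] := lift_orthogonal_projections ep eo.
have gproj t n : projection (g t n) by case: (gP n).
have sumP n : projection (\sum_t g t n) by case: (gP n); exact: projection_sum.
have compP n : projection (1 - \sum_t g t n).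
  by apply: projectionB; [exact: projection1|exact: sumP|exact: mul1r].
have SM : exists M : R, forall n, cnorm (\sum_t g t n) <= M.
  by exists 1 => n; exact: cnorm_projection_le1.
have sum1 : \forall n \near U, \sum_t g t n = 1.
  pose S : bounded_family (fun _ : nat => A) := BoundedFamily SM.
  have eS : (\pi_(ultraproduct UF (fun=> A)) (family_one (fun=> A)) = 
      \pi_(ultraproduct UF (fun=> A)) S)%qT.
    rewrite (@cls_sum _ _ _ UF _ _ g S) // cls1 -[LHS]e1.
    by apply: eq_bigr => t _; rewrite gc.
  apply: filterS (cls_near eS ltr01) => n /= n1.
  have := projection_eq0 (compP n) n1.
  by move/eqP; rewrite subr_eq0 => /eqP.
have mvn : \forall n \near U, forall i i', mvn_equivalent (g (inl i) n) (g (inl i') n).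
  apply: filter_forall => i; apply: filter_forall => i'.
  apply: (lift_mvn_equivalent (x := cv (i, i'))) => //.
    by rewrite ve gc.
  by rewrite vv gc.
have c0 : 0 < 32^-1 :> R by rewrite invr_gt0.
have close : \forall n \near U, forall j,
    cnorm (w n (enum_rank (inl (inr j) : V)) - g (inr j) n) < 32^-1.
  apply: filter_forall => j.
  by apply: (cls_near (a := fam _) _ c0); rewrite gc.
have [n [[sn mn] [cn wn]]] := filter_ex (filterI (filterI sum1 mvn)
  (filterI close (near_small _ c0))).
have [gn go] := gP n; have [w1 _ gapw] := wP n.
exists (fun t => g t n); split=> // j x y x1 y1.
(* The gap at [g] is at most [2^-n + 8 / 32] with [2^-n < 1 / 32]. *)
have wE : w n = assignment (fun t => w n (enum_rank (inl t : V)))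
    (fun p => w n (enum_rank (inr p : V))).
  apply: functional_extensionality_dep => i; rewrite /assignment.
  by case E : (enum_val i) => [t|p]; rewrite -E enum_valK.
have := gapw j x y x1 y1; rewrite wE corner_gap_eval.
have := corner_gap_lipschitz law (w1 (enum_rank (inl (inr j) : V)))
  (cnorm_projection_le1 (gn (inr j))) x1 y1.
have := cn j; lra.
Qed.

End Systems.

(** * Systems in finite direct sums of matrix algebras *)

Section Matrices.
Variables (R : realType) (d : nat).
Hypothesis d_gt0 : (0 < d)%N.
Local Notation C := R[i].
Local Notation T := ('I_d + 'I_d.-1)%type.

(** With [n.+1 = q * d + s] and [s < d], the first [q * d] basis vectors are
distributed among [d] classes by their index modulo [d], and each of the
remaining [s <= d.-1] vectors forms a class of its own. *)
Definition has_label n (t : T) (k : 'I_n.+1) : bool :=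
  let q := (n.+1 %/ d)%N in
  match t with
  | inl i => (k < q * d)%N && (k %% d == i)%N
  | inr j => (k == q * d + j :> nat)%N
  end.

Lemma has_label_unique n (k : 'I_n.+1) t t' :
  has_label t k -> has_label t' k -> t = t'.
Proof.
case: t t' => [i|j] [i'|j'] /=.
- by move=> /andP[_ /eqP ki] /andP[_ /eqP ki']; congr inl; apply: val_inj; rewrite /= -ki -ki'.
- by move=> /andP[kq _] /eqP kj; move: kq; rewrite kj ltnNge leq_addr.
- by move=> /eqP kj /andP[kq _]; move: kq; rewrite kj ltnNge leq_addr.
- by move=> /eqP kj /eqP kj'; congr inr; apply: val_inj;
    apply/eqP; rewrite /= -(eqn_add2l (n.+1 %/ d * d)) -kj -kj'.
Qed.

Lemma has_label_exists n (k : 'I_n.+1) : exists t, has_label t k.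
Proof.
have [kq|kq] := ltnP k (n.+1 %/ d * d).
  by exists (inl (Ordinal (ltn_pmod k d_gt0))); rewrite /= kq eqxx.
have kd : (k - n.+1 %/ d * d < d.-1)%N.
  have := ltn_ord k; have := ltn_pmod n.+1 d_gt0; rewrite {3}(divn_eq n.+1 d).
  by move: kq d_gt0; lia.
by exists (inr (Ordinal kd)); rewrite /= subnKC.
Qed.

Definition adj n (X : 'M[C]_n.+1) : 'M[C]_n.+1 := (map_mx Num.conj X)^T.

Definition label_proj n (t : T) : 'M[C]_n.+1 :=
  \matrix_(k, l) ((k == l) && has_label t k)%:R.

(** The graph of the bijection from the class [i] to the class [i'] that keeps
the position of a vector inside its class. *)
Definition block_related n (i i' : 'I_d) (m k : 'I_n.+1) : bool :=
  [&& has_label (inl i') m, has_label (inl i) k & (m %/ d == k %/ d)%N].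

Definition label_shift n (i : 'I_d * 'I_d) : 'M[C]_n.+1 :=
  \matrix_(m, k) (block_related i.1 i.2 m k)%:R.

Lemma block_related_inj n (i i' : 'I_d) (m k l : 'I_n.+1) :
  block_related i i' m k -> block_related i i' m l -> k = l.
Proof.
move=> /and3P[_ /= /andP[_ /eqP ki] /eqP mk] /and3P[_ /= /andP[_ /eqP li] /eqP ml].
by apply: val_inj; rewrite /= (divn_eq k d) (divn_eq l d) ki li -mk -ml.
Qed.

Lemma block_relatedC n (i i' : 'I_d) (m k : 'I_n.+1) :
  block_related i i' m k = block_related i' i k m.
Proof. by rewrite /block_related eq_sym andbCA. Qed.

Lemma block_related_exists n (i i' : 'I_d) (k : 'I_n.+1) :
  has_label (inl i) k -> exists m, block_related i i' m k.
Proof.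
move=> ki; have /andP[kq _] := ki.
have kd : (k %/ d < n.+1 %/ d)%N by rewrite ltn_divLR.
have md : (k %/ d * d + i' < n.+1 %/ d * d)%N.
  apply: (@leq_trans (k %/ d * d + d)); first by rewrite ltn_add2l.
  by rewrite addnC -mulSn leq_mul2r kd orbT.
have mn : (k %/ d * d + i' < n.+1)%N by rewrite (leq_trans md) // leq_divM.
exists (Ordinal mn); rewrite /block_related ki /= md modnMDl modn_small //.
by rewrite divnMDl // (divn_small (ltn_ord i')) addn0 !eqxx.
Qed.

Arguments has_label : simpl never.

Lemma label_proj_orthogonal n t t' : t != t' ->
  label_proj n t *m label_proj n t' = 0.
Proof.
move=> ne; apply/matrixP => k l; rewrite !mxE big1 // => m _.
rewrite !mxE -natrM mulnb; apply/eqP; rewrite pnatr_eq0 eqb0; apply/negP.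
move=> /andP[/andP[/eqP <- kt] /andP[_ kt']].
by rewrite (has_label_unique kt kt') eqxx in ne.
Qed.

Lemma label_proj_sum n : \sum_t label_proj n t = 1.
Proof.
apply/matrixP => k l; rewrite summxE !mxE.
have [t kt] := has_label_exists k.
rewrite (bigD1 t) //= mxE kt andbT big1 ?addr0 // => t' tt'.
rewrite mxE; case: (boolP (has_label t' k)) => kt'; last by rewrite andbF.
by rewrite (has_label_unique kt kt') eqxx in tt'.
Qed.

Lemma label_shift_source n (i : 'I_d * 'I_d) :
  adj (label_shift n i) *m label_shift n i = label_proj n (inl i.1).
Proof.
case: i => i i'; apply/matrixP => k l; rewrite !mxE /=.
under eq_bigr => m _ do rewrite !mxE rmorph_nat -natrM mulnb.
case: eqVneq => [<-|kl] /=; last first.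
  rewrite big1 // => m _; case: andP => // -[mk ml].
  by rewrite (block_related_inj mk ml) eqxx in kl.
case: (boolP (has_label _ k)) => ki; last first.
  by rewrite big1 // => m _; rewrite andbb /block_related (negbTE ki) andbF.
have [m mk] := @block_related_exists n i i' k ki.
rewrite (bigD1 m) //= mk big1 ?addr0 // => m' m'm; rewrite andbb.
case: (boolP (block_related i i' m' k)) => // m'k.
move: mk m'k; rewrite block_relatedC => mk; rewrite block_relatedC => m'k.
by rewrite (block_related_inj mk m'k) eqxx in m'm.
Qed.

Lemma adj_label_shift n (i : 'I_d * 'I_d) :
  adj (label_shift n i) = label_shift n (i.2, i.1).
Proof. by apply/matrixP => k l; rewrite !mxE rmorph_nat block_relatedC. Qed.

Lemma label_shift_range n (i : 'I_d * 'I_d) :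
  label_shift n i *m adj (label_shift n i) = label_proj n (inl i.2).
Proof.
rewrite -(label_shift_source n (i.2, i.1)) adj_label_shift.
by rewrite adj_label_shift; case: i.
Qed.

Lemma label_proj_adj n t : adj (label_proj n t) *m label_proj n t = label_proj n t.
Proof.
apply/matrixP => k l; rewrite !mxE (bigD1 k) //= big1 ?addr0.
  by rewrite !mxE rmorph_nat eqxx -natrM mulnb andbCA andbb.
move=> m mk; rewrite !mxE rmorph_nat (negbTE mk) /= mul0r //.
Qed.

(** The label [inr j] is carried by at most one basis vector, so the projection
has rank at most one and compresses every matrix to a multiple of itself. *)
Lemma label_proj_minimal n (j : 'I_d.-1) (X : 'M[C]_n.+1) :
  exists c, label_proj n (inr j) *m X *m label_proj n (inr j)
    = c *: label_proj n (inr j).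
Proof.
have label1 k l : has_label (inr j : T) k -> has_label (inr j : T) l -> k = l :> 'I_n.+1.
  by move=> /eqP kj /eqP lj; apply: val_inj; rewrite /= kj lj.
have E Y k l : (label_proj n (inr j) *m Y *m label_proj n (inr j)) k l
    = (has_label (inr j : T) k)%:R * Y k l * (has_label (inr j : T) l)%:R.
  rewrite mxE (bigD1 l) //= big1 ?addr0; last first.
    by move=> m ml; rewrite [label_proj _ _ m l]mxE (negbTE ml) mulr0.
  rewrite mxE (bigD1 k) //= big1 ?addr0; last first.
    by move=> m mk; rewrite [label_proj _ _ k m]mxE eq_sym (negbTE mk) mul0r.
  by rewrite !mxE !eqxx.
case: (pickP (fun k : 'I_n.+1 => has_label (inr j : T) k)) => [k0 kj|none].
  exists (X k0 k0); apply/matrixP => k l; rewrite E !mxE.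
  case: (boolP (has_label (inr j : T) k)) => kk; last by rewrite andbF !mul0r mulr0.
  rewrite -(label1 _ _ kj kk); case: (boolP (has_label (inr j : T) l)) => ll.
    by rewrite -(label1 _ _ kj ll) eqxx mul1r.
  rewrite mulr0; case: eqP => [e|_]; last by rewrite mulr0.
  by rewrite -e kj in ll.
exists 0; apply/matrixP => k l; rewrite E !mxE.
by have := none k => /= ->; rewrite !mul0r.
Qed.

Section DirectSum.
Variables (B : cstarAlgType R) (c : nat) (n : 'I_c.+1 -> nat).
Variable f : forall i : 'I_c.+1, {lrmorphism B -> 'M[C]_((n i).+1)}.
Hypothesis f_star : forall i x, f i (star x) = adj (f i x).
Hypothesis f_bij : forall y : forall i : 'I_c.+1, 'M[C]_((n i).+1),
  exists! x : B, forall i, f i x = y i.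

Lemma components_inj x y : (forall i, f i x = f i y) -> x = y.
Proof.
move=> xy; have [z [_ zP]] := f_bij (fun i => f i y).
by rewrite -(zP x xy) -(zP y).
Qed.

Lemma direct_sum_system : exists (e : T -> B) (v : 'I_d * 'I_d -> B),
  system e v /\ forall i j, f i (e (inr j)) = label_proj (n i) (inr j).
Proof.
have lift (y : forall i, 'M[C]_((n i).+1)) : exists x, forall i, f i x = y i.
  by have [x [xP _]] := f_bij y; exists x.
have /choice[e eP] t := lift (fun i => label_proj (n i) t).
have /choice[v vP] p := lift (fun i => label_shift (n i) p).
exists e, v; split=> [|i j]; last exact: eP.
split.
- by move=> t; apply: components_inj => i; rewrite rmorphM /= f_star !eP; exact: label_proj_adj.
- move=> t t' ne; apply: components_inj => i.
  by rewrite rmorphM rmorph0 /= !eP; exact: label_proj_orthogonal.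
- apply: components_inj => i; rewrite rmorph_sum rmorph1 /= -(label_proj_sum (n i)).
  by apply: eq_bigr => t _; rewrite eP.
- move=> p; apply: components_inj => i; rewrite rmorphM /= f_star eP vP.
  exact: label_shift_source.
- move=> p; apply: components_inj => i; rewrite rmorphM /= f_star eP vP.
  exact: label_shift_range.
Qed.

End DirectSum.

Lemma finite_dimensional_system (B : cstarAlgType R) : finite_dimensional B ->
  exists (e : T -> B) v, system e v /\
    forall j x y, corner_gap Commutative (e (inr j)) x y = 0.
Proof.
move=> [c [n [f [fs fb]]]].
have [e [v [ev fe]]] := direct_sum_system fs fb.
exists e, v; split=> // j x y; rewrite /corner_gap.
suff -> : e (inr j) * x * e (inr j) * (e (inr j) * y * e (inr j))
    = e (inr j) * y * e (inr j) * (e (inr j) * x * e (inr j)).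
  by rewrite subrr cnorm0.
apply: (components_inj fb) => i; rewrite !rmorphM /= !fe.
have [a aE] := label_proj_minimal j (f i x).
have [b bE] := label_proj_minimal j (f i y).
rewrite -!mulmxE aE bE -!scalemxAl -!scalemxAr !scalerA.
by rewrite [a * b]mulrC.
Qed.

Lemma matrix_algebra_system (B : cstarAlgType R) : matrix_algebra B ->
  exists (e : T -> B) v, system e v /\
    forall j x y, corner_gap Multiplicative (e (inr j)) x y = 0.
Proof.
move=> [n [f [fs fb]]].
pose n1 (i : 'I_1) := n.
pose f1 (i : 'I_1) : {lrmorphism B -> 'M[C]_((n1 i).+1)} := f.
have f1b : forall y : forall i : 'I_1, 'M[C]_((n1 i).+1),
    exists! x : B, forall i, f1 i x = y i.
  move=> y; have [g fg gf] := fb; exists (g (y ord0)).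
  split=> [i|x xP]; first by rewrite (ord1 i) /f1 gf.
  by rewrite -(xP ord0) /f1 fg.
have [e [v [ev fe]]] := @direct_sum_system B 0 n1 f1 (fun=> fs) f1b.
have corner_scalar j x : exists a : C, e (inr j) * x * e (inr j) = a *: e (inr j).
  have [a aE] := label_proj_minimal j (f x); exists a.
  apply: (components_inj f1b) => i; rewrite !rmorphM linearZ /= fe.
  by rewrite -!mulmxE; exact: aE.
exists e, v; split=> // j x y; rewrite /corner_gap.
have [a ->] := corner_scalar j x; have [b ->] := corner_scalar j y.
have ep : projection (e (inr j)) by case: ev => ee _ _ _ _; exact: projection_star_mul.
have [_ ejj] := ep.
rewrite -scalerAl -scalerAr scalerA ejj !cnormZ Normc.normcM.
case: (cnorm_projection ep) => ->; first by rewrite !mulr0 subrr normr0.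
by rewrite !mulr1 subrr normr0.
Qed.

End Matrices.

(** * The decomposition of the identity *)

(** The passage from the factors to [A], common to both parts: an approximate
system is transferred to [A] and replaced by an exact one. *)
Lemma decomposition_of_identity (R : realType) (d : nat) (law : corner_law)
    (A : cstarAlgType R) (J : Type) (U : set_system J) (UF : UltraFilter U)
    (B : J -> cstarAlgType R) :
  elementarily_equivalent A (ultraproduct UF B) ->
  (forall j, exists (e : 'I_d + 'I_d.-1 -> B j) v, system e v /\
    forall l x y, corner_gap law (e (inr l)) x y = 0) ->
  exists (p : 'I_d -> A) (r : 'I_(d.-1) -> A),
    [/\ forall i, projection (p i),
        mutually_orthogonal (fun k : 'I_d + 'I_(d.-1) =>
          match k with inl i => p i | inr j => r j end),
        1 = \sum_(i < d) p i + \sum_(j < d.-1) r j,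
        forall i i', mvn_equivalent (p i) (p i')
      & forall j, projection (r j) /\
          forall x y, cnorm x <= 1 -> cnorm y <= 1 ->
            corner_gap law (r j) x y <= 2^-1].
Proof.
move=> AP sysB.
pose V := ('I_d + 'I_d.-1 + 'I_d * 'I_d)%type.
have aP j : exists a : 'I_#|{: V}| -> B j, [/\ forall i, cnorm (a i) <= 1,
    forall k, star_poly_eval (@relation R d k) a = 0
  & forall l x y, gap (corner_gap_terms R law l).1.1 (corner_gap_terms R law l).1.2
      (corner_gap_terms R law l).2 (env_cons y (env_cons x a)) = 0].
  have [e [v [ev gap0]]] := sysB j; exists (assignment e v); split.
  - exact: system_norm_le1.
  - by apply/systemP.
  - by move=> l x y; rewrite corner_gap_eval.
have aP' j := projT2 (cid (aP j)).
have [|e [ep eo e1 emvn egap]] := @exact_system R d A law.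
  move=> eps eps0 eps1.
  apply: (@approximate_transfer R A J U UF B _ _ 'I_d.-1 (@relation R d)
    (fun l => (corner_gap_terms R law l).1.1) (fun l => (corner_gap_terms R law l).1.2)
    (fun l => (corner_gap_terms R law l).2) (fun j => projT1 (cid (aP j))) eps AP) => //.
  - by move=> j; case: (aP' j).
  - by move=> j; case: (aP' j).
  - by move=> j; case: (aP' j).
exists (fun i => e (inl i)), (fun j => e (inr j)); split=> //.
- by move=> [i|j] [i'|j'] ne; apply: eo.
- by rewrite -e1 big_sumType.
- by move=> j; split=> // x y; exact: egap.
Qed.

Theorem proposition5p6 (R : realType) (d : nat) (d_ge2 : (2 <= d)%N) :
  (forall A : cstarAlgType R, pseudomatricial A ->
     exists (p : 'I_d -> A) (r : 'I_(d.-1) -> A),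
       (forall i, projection (p i)) /\
       (forall j, projection (r j)) /\
       mutually_orthogonal (fun k : 'I_d + 'I_(d.-1) =>
         match k with inl i => p i | inr j => r j end) /\
       1 = \sum_(i < d) p i + \sum_(j < d.-1) r j /\
       (forall i i', mvn_equivalent (p i) (p i')) /\
       (forall j, minimal_projection (r j) \/ r j = 0)) /\
  (forall A : cstarAlgType R, pseudocompact A ->
     exists (p : 'I_d -> A) (r : 'I_(d.-1) -> A),
       (forall i, projection (p i)) /\
       (forall j, projection (r j)) /\
       mutually_orthogonal (fun k : 'I_d + 'I_(d.-1) =>
         match k with inl i => p i | inr j => r j end) /\
       1 = \sum_(i < d) p i + \sum_(j < d.-1) r j /\
       (forall i i', mvn_equivalent (p i) (p i')) /\
       (forall j, abelian_projection (r j) \/ r j = 0)).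
Proof.
have d_gt0 : (0 < d)%N := ltnW d_ge2.
split=> A [J [U [UF [B [Bj AP]]]]].
- have [p [r [pp po p1 pmvn rgap]]] := decomposition_of_identity AP
    (fun j => matrix_algebra_system d_gt0 (Bj j)).
  exists p, r; split=> //; split; first by move=> j; case: (rgap j).
  do 3![split=> //].
  by move=> j; have [rp gapj] := rgap j; exact: minimal_of_multiplicative_norm.
- have [p [r [pp po p1 pmvn rgap]]] := decomposition_of_identity AP
    (fun j => finite_dimensional_system d_gt0 (Bj j)).
  exists p, r; split=> //; split; first by move=> j; case: (rgap j).
  do 3![split=> //].
  by move=> j; have [rp gapj] := rgap j; left; exact: abelian_of_small_commutators.
Qed.
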